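(* Let $(E,e,T)$ be a conditional Riesz triple. Then for every $p$ with $1\leq p\leq\infty$ the space $L^{p}(T)$ is sequentially strongly complete; that is, for every strongly Cauchy sequence $(f_n)$ in $L^p(T)$ there exists $f\in L^p(T)$ such that $N_p(f_n-f)\to 0$ in order.
   Context: A conditional Riesz triple $(E,e,T)$ consists of a Dedekind complete Riesz space (vector lattice) $E$, a weak order unit $e$ of $E$, and a conditional expectation operator $T$ on $E$, i.e. an order continuous, strictly positive ($x>0$ implies $Tx>0$) linear projection $T:E\to E$ whose range $R(T)$ is a Dedekind complete Riesz subspace of $E$, with $Te=e$. $E^u$ denotes the universal completion of $E$, equipped with its unique $f$-algebra multiplication with identity $e$; real powers $y^r$ ($r>0$) of elements $y\in E^u_+$ are taken in $E^u$ (functional calculus relative to $e$). The natural domain $L^1(T)$ of $T$ is $D-D$, where $D$ is the set of all $x\in E^u_+$ for which there is an increasing net $(x_\alpha)$ in $E_+$ with $x_\alpha\uparrow x$ in $E^u$ and $(Tx_\alpha)$ order bounded in $E^u$; $T$ extends uniquely to a conditional expectation operator on $L^1(T)$, given on $D$ by $Tx=\sup_\alpha Tx_\alpha$. From now on $T$ denotes this extension and $R(T)$ its range. For $1\le p<\infty$, $L^p(T)=\{x\in L^1(T): |x|^p\in L^1(T)\}$ and $N_p(x)=(T|x|^p)^{1/p}$. For $p=\infty$, $L^\infty(T)=\{x\in L^1(T): |x|\le u \text{ for some } u\in R(T)\}$ and $N_\infty(x)=\inf\{u\in R(T): |x|\le u\}$. These are $R(T)$-valued norms. Order convergence: a net $(x_\alpha)$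 converges in order to $x$ if there is a net $(v_\gamma)$ with $v_\gamma\downarrow 0$ such that for every $\gamma$ there is $\alpha_0$ with $|x_\alpha-x|\le v_\gamma$ for all $\alpha\ge\alpha_0$. It is taken here in $L^1(T)$ (or, equivalently for these norms, in $R(T)$). A sequence $(f_n)$ in $L^p(T)$ is strongly Cauchy if the double-indexed net $(N_p(f_n-f_m))_{(n,m)}$ converges to $0$ in order as $n,m\to\infty$. It converges strongly to $f\in L^p(T)$ if $N_p(f_n-f)\to0$ in order. *)

(* Defs.v *)
From HB Require Import structures.
From mathcomp Require Import all_boot all_order all_algebra.
From mathcomp Require Import boolp classical_sets reals constructive_ereal exp.

Set Implicit Arguments.
Unset Strict Implicit.
Unset Printing Implicit Defensive.

Import Order.TTheory GRing.Theory Num.Theory.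
Local Open Scope classical_set_scope.
Local Open Scope ring_scope.

(* Ordered real vector spaces in which any two elements have a join and a meet.
   The lattice operations are fields of their own, and not those of
   [Order.Lattice], because HB refuses a join of [GRing.Zmodule] and
   [Order.Lattice] that is not comparable with [Num.RealDomain].  By
   antisymmetry they are determined by the order. *)
HB.mixin Record isRiesz (R : realType) V
    of GRing.Lmodule R V & Num.POrderedZmodule V := {
  riesz_leD2r : forall x y z : V, x <= y -> x + z <= y + z ;
  riesz_scaler_ge0 : forall (a : R) (x : V), 0 <= a -> 0 <= x -> 0 <= a *: x ;
  rjoin : V -> V -> V ;
  rmeet : V -> V -> V ;
  rjoin_le : forall x y z : V, (rjoin x y <= z) = (x <= z) && (y <= z) ;
  le_rmeet : forall x y z : V, (z <= rmeet x y) = (z <= x) && (z <= y)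
}.

#[short(type="rieszType")]
HB.structure Definition Riesz (R : realType) :=
  { V of GRing.Lmodule R V & Num.POrderedZmodule V & isRiesz R V }.

Section Riesz_basics.
Context {R : realType} {V : rieszType R}.
Implicit Types (x y : V) (A S : set V).

Definition rabs x : V := rjoin x (- x).

Definition rpos x : V := rjoin x 0.

Definition disjoint_elts x y := rmeet (rabs x) (rabs y) = 0.

Definition weak_order_unit (e : V) :=
  0 <= e /\ forall x, rmeet (rabs x) e = 0 -> x = 0.

Definition riesz_subspace S :=
  [/\ S 0, forall (a : R) x y, S x -> S y -> S (a *: x + y)
    & forall x y, S x -> S y -> S (rjoin x y) /\ S (rmeet x y)].

(* Bounds and suprema are relative to [S], with the order induced from [V]. *)
Definition dedekind_complete_in S :=
  forall A, A `<=` S -> A !=set0 -> (S `&` ubound A) !=set0 ->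
    exists s, (S `&` ubound A) s /\ lbound (S `&` ubound A) s.

Definition dedekind_complete := dedekind_complete_in setT.

Definition laterally_complete :=
  forall A, A !=set0 -> (forall x, A x -> 0 <= x) ->
    (forall x y, A x -> A y -> x <> y -> disjoint_elts x y) ->
    supremums A !=set0.

Definition order_bounded A := has_lbound A /\ has_ubound A.

End Riesz_basics.
Arguments dedekind_complete {R} V.
Arguments laterally_complete {R} V.

Definition directed (I : Type) (le : I -> I -> Prop) :=
  [/\ inhabited I, forall i, le i i,
      forall i j k, le i j -> le j k -> le i k
    & forall i j, exists k, le i k /\ le j k].

Section Order_convergence.
Context {R : realType} {V : rieszType R}.

(* [v] decreases to 0, the infimum being taken in the ordered space [S]. *)
Definition decreases_to0_in (S : set V) (I : Type) (le : I -> I -> Prop)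
    (v : I -> V) :=
  [/\ forall i, S (v i), forall i j, le i j -> v j <= v i
    & (S `&` lbound (range v)) 0 /\ ubound (S `&` lbound (range v)) 0].

Definition order_cvg_in (S : set V) (I : Type) (le : I -> I -> Prop)
    (x : I -> V) (l : V) :=
  exists (J : Type) (leJ : J -> J -> Prop) (v : J -> V),
    [/\ directed leJ, decreases_to0_in S leJ v
      & forall j, exists i0, forall i, le i0 i -> rabs (x i - l) <= v j].

End Order_convergence.

Definition order_continuous (R : realType) (V W : rieszType R) (T : V -> W) :=
  forall (I : Type) (le : I -> I -> Prop) (x : I -> V) (l : V),
    directed le -> order_cvg_in setT le x l ->
    order_cvg_in setT le (T \o x) (T l).

Definition cond_expectation (R : realType) (E : rieszType R) (e : E)
    (T : {linear E -> E}) :=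
  [/\ order_continuous T,
      forall x, 0 < x -> 0 < T x,
      forall x, T (T x) = T x,
      riesz_subspace (range T) /\ dedekind_complete_in (range T)
    & T e = e].

Definition cond_riesz_triple (R : realType) (E : rieszType R) (e : E)
    (T : {linear E -> E}) :=
  [/\ dedekind_complete E, weak_order_unit e & cond_expectation e T].

(* [Eu] is universally complete and [iota] identifies [E] with an order dense
   Riesz subspace of it; this determines [(Eu, iota)] up to isomorphism. *)
Definition universal_completion (R : realType) (E Eu : rieszType R)
    (iota : {linear E -> Eu}) :=
  [/\ dedekind_complete Eu, laterally_complete Eu,
      injective iota,
      forall x y, iota (rjoin x y) = rjoin (iota x) (iota y)
    & forall u : Eu, 0 < u -> exists2 x : E, 0 < x & iota x <= u].

Section Functional_calculus.
Context {R : realType} {V : rieszType R}.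

(* The component of [e] in the band generated by [(y - t e)^+]; in a function
   representation with [e] as constant 1, the indicator of [y > t]. *)
Definition spectral_comp (e y : V) (t : R) : V :=
  supremum 0 [set rmeet (k%:R *: rpos (y - t *: e)) e | k in [set: nat]].

(* The element phi(y) = \int phi(t) dE_t for phi >= 0, with E_t the complement
   of [spectral_comp e y t] in [e]: the supremum of the elements obtained from
   the finite step functions, constant on half-open intervals ]a_i, a_(i+1)],
   that lie below phi. *)
Definition spectral_fun (e : V) (phi : R -> R) (y : V) : V :=
  supremum 0 [set z | exists (n : nat) (a c : nat -> R),
    (forall i, (i < n)%N -> a i <= a i.+1 /\
       forall t, a i < t -> t <= a i.+1 -> c i <= phi t) /\
    z = \sum_(i < n) c i *: (spectral_comp e y (a i) -
                             spectral_comp e y (a i.+1))].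

(* For y >= 0 and r > 0; for r a natural number this is the power for the
   f-algebra multiplication with identity [e].  The truncation is needed
   because [powR] takes the value 1 at negative reals. *)
Definition rpow (e : V) (r : R) (y : V) : V :=
  spectral_fun e (fun t => Num.max 0 t `^ r) y.

End Functional_calculus.

Section Lp.
Context {R : realType} {E Eu : rieszType R}.
Variables (iota : {linear E -> Eu}) (e : E) (T : {linear E -> E}).

Definition dom_net (I : Type) (le : I -> I -> Prop) (xs : I -> E) (x : Eu) :=
  [/\ directed le,
      forall i j, le i j -> xs i <= xs j,
      forall i, 0 <= xs i,
      supremums (range (iota \o xs)) x
    & order_bounded (range (iota \o (T \o xs)))].

Definition domD : set Eu :=
  [set x | exists (I : Type) (le : I -> I -> Prop) (xs : I -> E),
     dom_net le xs x].

(* The graph of the extension of [T] to [domD]. *)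
Definition TD (x z : Eu) :=
  exists (I : Type) (le : I -> I -> Prop) (xs : I -> E),
    dom_net le xs x /\ supremums (range (iota \o (T \o xs))) z.

Definition L1 : set Eu := [set x | exists a b, [/\ domD a, domD b & x = a - b]].

(* The extension of [T] to [L1]; the junk value outside [L1] is 0. *)
Definition Text (x : Eu) : Eu :=
  xget 0 [set z | exists a b s t, [/\ TD a s, TD b t, x = a - b & z = s - t]].

Definition RT : set Eu := [set Text x | x in L1].

(* The case -oo is junk: exponents are used in [1, +oo] only. *)
Definition Lp (p : \bar R) : set Eu :=
  match p with
  | r%:E%E => [set x | L1 x /\ L1 (rpow (iota e) r (rabs x))]
  | +oo%E => [set x | L1 x /\ exists2 u, RT u & rabs x <= u]
  | -oo%E => set0
  end.

Definition Np (p : \bar R) (x : Eu) : Eu :=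
  match p with
  | r%:E%E => rpow (iota e) r^-1 (Text (rpow (iota e) r (rabs x)))
  | +oo%E => infimum 0 [set u | RT u /\ rabs x <= u]
  | -oo%E => 0
  end.

(* [nat * nat] carries the product order. *)
Definition strongly_cauchy (p : \bar R) (f : nat -> Eu) :=
  order_cvg_in L1
    (fun m n : nat * nat => (m.1 <= n.1)%N /\ (m.2 <= n.2)%N)
    (fun nm => Np p (f nm.1 - f nm.2)) 0.

Definition strongly_cvg (p : \bar R) (f : nat -> Eu) (g : Eu) :=
  order_cvg_in L1 (fun m n : nat => (m <= n)%N) (fun n => Np p (f n - g)) 0.

End Lp.

(* Main.v *)
Require Import Defs.
From HB Require Import structures.
From mathcomp Require Import all_boot all_order all_algebra.
From mathcomp Require Import boolp classical_sets reals constructive_ereal exp.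
From mathcomp Require Import ring lra.

Set Implicit Arguments.
Unset Strict Implicit.
Unset Printing Implicit Defensive.

Import Order.TTheory GRing.Theory Num.Theory.
Local Open Scope classical_set_scope.
Local Open Scope ring_scope.

(** The limit of a strongly Cauchy sequence [f] is built as in the Riesz-Fischer
    theorem, from a subsequence whose increments are summable.  Since the norm
    takes values in the range of [T], the indices of that subsequence must be
    allowed to vary: they are stopping times with respect to the events of the
    range.

    For finite [p] put [X m n = T |f m - f n| ^ p].  For each [k] the components of
    the unit on which [X m n > level k] for some [m, n >= N] decrease to 0 as [N]
    grows, so their successive differences cut the unit into disjoint pieces, and
    lateral completeness of [Eu] glues an element [G k] that agrees with one
    [f n], [n >= k], on each piece ([glue]).  The operator respects
    inequalities on events ([Text_disjoint], [dominated_locally]), hence the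
    increments [d k = |G (k + 1) - G k|] satisfy [T (d k ^ p) <= level k].  Convexity of
    the power ([rpow_sum_le]) bounds the images of the partial sums of [d] by a
    multiple of the unit.  An increasing sequence with bounded images is order
    bounded ([dominated_bounded]): strict positivity excludes an event on which
    it tends to infinity, and the bounds found elsewhere glue.  So [sum d]
    exists, the [G k] converge in order to some [g], and monotone convergence
    ([dominated_lub]) gives [T |f n - g| ^ p <= W] whenever [X n m <= W] for all
    large [m] ([limit_exists]).  The net that witnesses the Cauchy condition
    therefore also witnesses the convergence.

    For [p] infinite the norms [a n = sup_(m >= n) |f n - f m|] lie in the range, and
    the supremum of the [f n - a n] is within [a n] of every [f n].

    Two devices replace a representation of the spaces by functions.
    Inequalities are localized: [le_on c x y] says that [x <= y] on the support of
    [c], and it is enough to prove it on a dense family of smaller supports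
    ([le_on_dense]), on which finitely many elements are nearly constant
    ([value_dense]).  This turns the functional calculus into inequalities
    between reals; for [p >= 1] it identifies the power with the supremum of the
    tangents to [t ^ p] ([tangent_le_rpow], [rpow_le_tangents]).  And the extension
    of [T] is computed from the canonical net of all elements of [E] below a
    given one ([dominated], [extends]). *)

(** * Linear identities in a module *)

(** Two combinations of the same vectors agree as soon as the coefficients of each
    vector agree.  By reflection this reduces an identity in a module to
    identities between its scalars. *)
Section Linear_expressions.
Context {R : realType} {V : lmodType R}.

Inductive lexp :=
  | LVar of nat | LZero | LAdd of lexp & lexp | LOpp of lexp
  | LScale of R & lexp.

Fixpoint leval (env : seq V) t : V :=
  match t with
  | LVar i => nth 0 env i
  | LZero => 0
  | LAdd a b => leval env a + leval env b
  | LOpp a => - leval env a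
  | LScale k a => k *: leval env a
  end.

Fixpoint lcoef (i : nat) t : R :=
  match t with
  | LVar j => if Nat.eqb i j then 1 else 0
  | LZero => 0
  | LAdd a b => lcoef i a + lcoef i b
  | LOpp a => - lcoef i a
  | LScale k a => k * lcoef i a
  end.

Fixpoint lwf (n : nat) t : bool :=
  match t with
  | LVar j => Nat.ltb j n
  | LZero => true
  | LAdd a b => lwf n a && lwf n b
  | LOpp a => lwf n a
  | LScale k a => lwf n a
  end.

Fixpoint lsame (n : nat) s t : Prop :=
  if n is m.+1 then lcoef m s = lcoef m t /\ lsame m s t else True.

Lemma leval_coef env t : lwf (size env) t ->
  leval env t = \sum_(i < size env) lcoef i t *: nth 0 env i.
Proof.
elim: t => [j|_|a IHa b IHb /andP[/IHa ha /IHb hb]|a IHa /IHa ha|k a IHa /IHa ha] /=.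
- move=> /PeanoNat.Nat.ltb_spec0/ssrnat.ltP jn.
  rewrite (bigD1 (Ordinal jn)) //= PeanoNat.Nat.eqb_refl scale1r big1 ?addr0 //.
  move=> i /eqP ij; case: PeanoNat.Nat.eqb_spec => [eij|_]; last by rewrite scale0r.
  by case: ij; apply: val_inj.
- by rewrite big1 // => i _; rewrite scale0r.
- by rewrite ha hb -big_split /=; apply: eq_bigr => i _; rewrite scalerDl.
- by rewrite ha -sumrN; apply: eq_bigr => i _; rewrite scaleNr.
- by rewrite ha scaler_sumr; apply: eq_bigr => i _; rewrite scalerA.
Qed.

Lemma leval_eq env s t : lwf (size env) s -> lwf (size env) t ->
  lsame (size env) s t -> leval env s = leval env t.
Proof.
move=> ws wt st; rewrite (leval_coef ws) (leval_coef wt); apply: eq_bigr => i _.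
congr (_ *: _); elim: (size env) (i : nat) (ltn_ord i) st => // n IHn j.
by rewrite ltnS leq_eqVlt => /orP[/eqP-> [] //|jn [_]]; apply: IHn.
Qed.

End Linear_expressions.

Ltac lin_mem x env :=
  lazymatch env with
  | nil => constr:(false)
  | cons x _ => constr:(true)
  | cons _ ?l => lin_mem x l
  end.

Ltac lin_index x env :=
  lazymatch env with
  | cons x _ => constr:(0%N)
  | cons _ ?l => let n := lin_index x l in constr:(S n)
  end.

Ltac lin_atoms t env :=
  lazymatch t with
  | (?a + ?b)%R => let env' := lin_atoms a env in lin_atoms b env'
  | (- ?a)%R => lin_atoms a env
  | (_ *: ?a)%R => lin_atoms a env
  | (0)%R => env
  | _ => lazymatch lin_mem t env with
         | true => env
         | false => constr:(cons t env)
         end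
  end.

Ltac lin_reify R t env :=
  lazymatch t with
  | (?a + ?b)%R =>
      let a' := lin_reify R a env in let b' := lin_reify R b env in
      constr:(LAdd a' b')
  | (- ?a)%R => let a' := lin_reify R a env in constr:(LOpp a')
  | (?k *: ?a)%R => let a' := lin_reify R a env in constr:(LScale k a')
  | (0)%R => constr:(@LZero R)
  | _ => let n := lin_index t env in constr:(@LVar R n)
  end.

(** The scalar ring has to be given, because the module of the goal does not
    determine it syntactically; [tac] proves the identities between scalars. *)
Ltac linear_with R tac :=
  lazymatch goal with
  | |- @eq ?V ?a ?b =>
      let env := lin_atoms a (@nil V) in
      let env := lin_atoms b env in
      let a' := lin_reify R a env in
      let b' := lin_reify R b env in
      refine (@leval_eq R _ env a' b' isT isT _);
      cbn [lsame size lcoef Nat.eqb]; repeat split; tac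
  end.
Tactic Notation "linear" constr(R) := linear_with R ltac:(ring).


(** * Joins, meets and absolute values *)

Section Riesz_arithmetic.
Context {R : realType} {V : rieszType R}.
Implicit Types (x y z a b c w : V) (k : R) (A : set V).

Lemma rle_add a b c d : a <= b -> c <= d -> a + c <= b + d.
Proof.
move=> ab cd; apply: le_trans (riesz_leD2r _ _ c ab) _.
by rewrite addrC (addrC b); apply: riesz_leD2r.
Qed.

(** Proves an inequality from one with the same difference of sides, the
    comparison of differences being left to [linear]. *)
Lemma rle_of a b x y : a <= b -> y - x = b - a -> x <= y.
Proof.
move=> ab e; have /(riesz_leD2r _ _ (x - a)) := ab.
suff [-> ->] : a + (x - a) = x /\ b + (x - a) = y by [].
split; first by linear R.
by transitivity (b - a + x); [linear R | rewrite -e; linear R].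
Qed.

Lemma rsub_ge0 x y : (0 <= y - x) = (x <= y).
Proof. by apply/idP/idP => h; apply: (rle_of h); linear R. Qed.

Lemma rscale_le k x y : 0 <= k -> x <= y -> k *: x <= k *: y.
Proof.
move=> k0; rewrite -rsub_ge0 => /(riesz_scaler_ge0 _ _ k0) h.
by apply: (rle_of h); linear R.
Qed.

Lemma rscale_lel k k' x : 0 <= x -> k <= k' -> k *: x <= k' *: x.
Proof.
move=> x0; rewrite -subr_ge0 => /riesz_scaler_ge0 /(_ x0) h.
by apply: (rle_of h); linear R.
Qed.

Lemma radd_ge0 x y : 0 <= x -> 0 <= y -> 0 <= x + y.
Proof. by move=> /rle_add h /h; rewrite addr0. Qed.

Lemma rscale_ge0 k x : 0 <= k -> 0 <= x -> 0 <= k *: x.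
Proof. exact: riesz_scaler_ge0. Qed.

Lemma rsum_ge0 n (F : nat -> V) :
  (forall i, 0 <= F i) -> 0 <= \sum_(i < n) F i.
Proof. by move=> F0; elim/big_ind: _ => // x y; apply: radd_ge0. Qed.

Lemma ropp_le x y : (- x <= - y) = (y <= x).
Proof. by apply/idP/idP => h; apply: (rle_of h); linear R. Qed.

Lemma rjoinl x y : x <= rjoin x y.
Proof. by have := lexx (rjoin x y); rewrite rjoin_le => /andP[]. Qed.

Lemma rjoinr x y : y <= rjoin x y.
Proof. by have := lexx (rjoin x y); rewrite rjoin_le => /andP[]. Qed.

Lemma rmeetl x y : rmeet x y <= x.
Proof. by have := lexx (rmeet x y); rewrite le_rmeet => /andP[]. Qed.

Lemma rmeetr x y : rmeet x y <= y.
Proof. by have := lexx (rmeet x y); rewrite le_rmeet => /andP[]. Qed.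

Lemma rjoin_lub x y z : x <= z -> y <= z -> rjoin x y <= z.
Proof. by rewrite rjoin_le => -> ->. Qed.

Lemma rmeet_glb x y z : z <= x -> z <= y -> z <= rmeet x y.
Proof. by rewrite le_rmeet => -> ->. Qed.

Lemma rjoinC x y : rjoin x y = rjoin y x.
Proof. by apply/le_anti; rewrite !rjoin_lub ?rjoinl ?rjoinr. Qed.

Lemma rmeetC x y : rmeet x y = rmeet y x.
Proof. by apply/le_anti; rewrite !rmeet_glb ?rmeetl ?rmeetr. Qed.

Lemma rmeet_le2 x y x' y' : x <= x' -> y <= y' -> rmeet x y <= rmeet x' y'.
Proof.
by move=> h h'; rewrite rmeet_glb ?(le_trans (rmeetl _ _) h) ?(le_trans (rmeetr _ _) h').
Qed.

Lemma rmeet_eql x y : x <= y -> rmeet x y = x.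
Proof. by move=> xy; apply/le_anti; rewrite rmeetl rmeet_glb. Qed.

Lemma rmeet_ge0 x y : 0 <= x -> 0 <= y -> 0 <= rmeet x y.
Proof. exact: rmeet_glb. Qed.

Lemma rjoinD x y z : rjoin (x + z) (y + z) = rjoin x y + z.
Proof.
apply/le_anti/andP; split.
  by apply: rjoin_lub; apply: riesz_leD2r; [exact: rjoinl | exact: rjoinr].
have h : rjoin x y <= rjoin (x + z) (y + z) - z.
  apply: rjoin_lub.
    by apply: (rle_of (rjoinl (x + z) (y + z))); linear R.
  by apply: (rle_of (rjoinr (x + z) (y + z))); linear R.
by apply: (rle_of h); linear R.
Qed.

Lemma radd_join_meet x y : rjoin x y + rmeet x y = x + y.
Proof.
apply/le_anti/andP; split.
  have h : rjoin x y <= x + y - rmeet x y.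
    apply: rjoin_lub.
      by apply: (rle_of (rmeetr x y)); linear R.
    by apply: (rle_of (rmeetl x y)); linear R.
  by apply: (rle_of h); linear R.
have h : x + y - rjoin x y <= rmeet x y.
  apply: rmeet_glb.
    by apply: (rle_of (rjoinr x y)); linear R.
  by apply: (rle_of (rjoinl x y)); linear R.
by apply: (rle_of h); linear R.
Qed.

Lemma rpos_ge0 x : 0 <= rpos x. Proof. exact: rjoinr. Qed.

Lemma rpos_ge x : x <= rpos x. Proof. exact: rjoinl. Qed.

Lemma rpos_lub x z : 0 <= z -> x <= z -> rpos x <= z.
Proof. by move=> ? ?; apply: rjoin_lub. Qed.

Lemma rpos_le x y : x <= y -> rpos x <= rpos y.
Proof. by move=> h; rewrite rpos_lub ?rpos_ge0 ?(le_trans h (rpos_ge _)). Qed.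

Lemma rpos_id x : 0 <= x -> rpos x = x.
Proof. by move=> h; apply/le_anti; rewrite rpos_ge rpos_lub. Qed.

Lemma rpos_subN x : rpos x - rpos (- x) = x.
Proof.
have h : rpos x = rpos (- x) + x.
  rewrite /rpos -rjoinD rjoinC; congr rjoin; linear R.
by rewrite h; linear R.
Qed.

Lemma rmeet_pos_neg x : rmeet (rpos x) (rpos (- x)) = 0.
Proof.
apply/le_anti/andP; split; last by rewrite rmeet_ge0 ?rpos_ge0.
set m := rmeet _ _.
have h1 : rpos x <= rpos x - m.
  apply: rpos_lub; first by rewrite rsub_ge0 rmeetl.
  have := rmeetr (rpos x) (rpos (- x)); rewrite -/m => h.
  by rewrite -{1}(rpos_subN x); apply: (rle_of h); linear R.
by apply: (rle_of h1); linear R.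
Qed.

Lemma rabs_le x z : (rabs x <= z) = (x <= z) && (- x <= z).
Proof. exact: rjoin_le. Qed.

Lemma rabs_lub x z : x <= z -> - x <= z -> rabs x <= z.
Proof. by rewrite rabs_le => -> ->. Qed.

Lemma rabs_ge x : x <= rabs x. Proof. exact: rjoinl. Qed.

Lemma rabs_geN x : - x <= rabs x. Proof. exact: rjoinr. Qed.

Lemma rhalf_ge0 x : 0 <= x + x -> 0 <= x.
Proof.
move=> h; have /(rscale_le (k := 2^-1)) /(_ h) h' : 0 <= (2^-1 : R) by rewrite invr_ge0.
by apply: (rle_of h'); linear_with R ltac:(field).
Qed.

Lemma rabs_ge0 x : 0 <= rabs x.
Proof.
apply: rhalf_ge0.
by have h := rle_add (rabs_ge x) (rabs_geN x); apply: (rle_of h); linear R.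
Qed.

Lemma rabs_id x : 0 <= x -> rabs x = x.
Proof.
move=> x0; apply/le_anti; rewrite rabs_ge rabs_lub //.
have h := rle_add x0 x0; by apply: (rle_of h); linear R.
Qed.

Lemma rabsN x : rabs (- x) = rabs x.
Proof. by rewrite /rabs opprK rjoinC. Qed.

Lemma rabs_distC x y : rabs (x - y) = rabs (y - x).
Proof. by rewrite -rabsN opprB. Qed.

Lemma rabsD x y : rabs (x + y) <= rabs x + rabs y.
Proof.
apply: rabs_lub; rewrite ?opprD; apply: rle_add; rewrite ?rabs_ge ?rabs_geN //.
Qed.

Lemma rpos_le_abs x : rpos x <= rabs x.
Proof. by rewrite rpos_lub ?rabs_ge ?rabs_ge0. Qed.

(** With [z] the left side, [z - b] is below [a] and [c], so [z - a /\ c] is below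
    [b] and [c]. *)
Lemma rmeetDl_le a b c : 0 <= a -> 0 <= b -> 0 <= c ->
  rmeet (a + b) c <= rmeet a c + rmeet b c.
Proof.
move=> a0 b0 c0; set z := rmeet (a + b) c.
have zab : z <= a + b := rmeetl _ _.
have zc : z <= c := rmeetr _ _.
have h : z - rmeet a c <= rmeet b c.
  apply: rmeet_glb.
    have h : z - b <= rmeet a c.
      apply: rmeet_glb; first by apply: (rle_of zab); linear R.
      by apply: le_trans zc; apply: (rle_of b0); linear R.
    by apply: (rle_of h); linear R.
  apply: le_trans zc; have h := rmeet_ge0 a0 c0.
  by apply: (rle_of h); linear R.
by apply: (rle_of h); linear R.
Qed.

End Riesz_arithmetic.

(** * Suprema and the Archimedean property *)

Section Suprema.
Context {R : realType} {V : rieszType R}.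
Implicit Types (x y z a b c w : V) (k : R) (A : set V).

(** [supremums A s] with the bound conditions unfolded, so that both halves apply
    directly. *)
Definition is_lub A s := (forall a, A a -> a <= s) /\
  (forall z, (forall a, A a -> a <= z) -> s <= z).

Lemma lub_unique A s t : is_lub A s -> is_lub A t -> s = t.
Proof.
by move=> [s1 s2] [t1 t2]; apply/le_anti; rewrite s2 // t2.
Qed.

Lemma supremum_lub A s : A !=set0 -> is_lub A s -> supremum 0 A = s.
Proof.
move=> /set0P A0 As; rewrite /supremum (negbTE A0).
by case: xgetP => [t _ At|/(_ s)//]; apply: lub_unique As.
Qed.

Lemma lub_exists A b : dedekind_complete V -> A !=set0 ->
  (forall a, A a -> a <= b) -> exists s, is_lub A s.
Proof.
move=> dc A0 Ab; case: (dc A) => //; first by exists b.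
move=> s [[_ s1] s2]; exists s; split => // z zA; exact: s2.
Qed.

Lemma supremumP A b : dedekind_complete V -> A !=set0 ->
  (forall a, A a -> a <= b) -> is_lub A (supremum 0 A).
Proof.
move=> dc A0 Ab; have [s As] := lub_exists dc A0 Ab.
by rewrite (supremum_lub A0 As).
Qed.

Lemma infimumP A b : dedekind_complete V -> A !=set0 ->
  (forall a, A a -> b <= a) -> (forall a, A a -> infimum 0 A <= a) /\
  (forall z, (forall a, A a -> z <= a) -> z <= infimum 0 A).
Proof.
move=> dc A0 Ab; have [//||s [s1 s2]] := @lub_exists [set - a | a in A] (- b) dc.
- by case: A0 => a Aa; exists (- a), a.
- by move=> _ [a Aa <-]; rewrite ropp_le Ab.
have Ai : infimums A (- s).
  split => [a Aa|z zA].
    by rewrite -ropp_le opprK s1 //; exists a.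
  by rewrite -ropp_le opprK s2 // => _ [a Aa <-]; rewrite ropp_le zA.
rewrite /infimum ifF; last by apply/negbTE/set0P.
case: xgetP => [t _ [t1 t2]|/(_ (- s))//]; split => [a /t1//|z zA].
by apply: t2 => a /zA.
Qed.

(** If [s] is the supremum of the multiples [n x], then [s - x] bounds them too. *)
Lemma archimedean x b : dedekind_complete V ->
  (forall n : nat, n%:R *: x <= b) -> x <= 0.
Proof.
move=> dc xb; have [//||s [s1 s2]] := @lub_exists [set n%:R *: x | n in setT] b dc.
- by exists (0%:R *: x), 0%N.
- by move=> _ [n _ <-].
have h : s <= s - x.
  apply: s2 => _ [n _ <-].
  have h : n.+1%:R *: x <= s by apply: s1; exists n.+1.
  by apply: (rle_of h); linear R.
by apply: (rle_of h); linear R.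
Qed.

Lemma archimedean_inv x b : dedekind_complete V ->
  (forall d : R, 0 < d -> x <= d *: b) -> x <= 0.
Proof.
move=> dc xb; apply: (@archimedean _ (rpos b)) => // -[|n].
  by rewrite scale0r rpos_ge0.
have h : (0 : R) < n.+1%:R^-1 by rewrite invr_gt0 ltr0n.
have := rscale_le (ler0n R n.+1) (xb _ h).
rewrite scalerA mulfV ?pnatr_eq0 // scale1r => /le_trans; apply; exact: rpos_ge.
Qed.

(** The identity [a = a \/ c + a /\ c - c] turns a bound of the meets with [c] into a
    bound of [A]; this is the infinite distributive law. *)
Lemma rmeet_lub A s c z : is_lub A s -> (forall a, A a -> rmeet a c <= z) ->
  rmeet s c <= z.
Proof.
move=> [s1 s2] Az.
have h : s <= rjoin s c + z - c.
  apply: s2 => a Aa.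
  have h1 : rjoin a c <= rjoin s c.
    by rewrite rjoin_lub ?rjoinr // (le_trans (s1 _ Aa)) ?rjoinl.
  have h2 := radd_join_meet a c; have h3 := rle_add h1 (Az _ Aa).
  apply: (rle_of h3); rewrite h2; linear R.
have h2 := radd_join_meet s c.
apply: (rle_of h); transitivity (z + rjoin s c - (rjoin s c + rmeet s c)).
  linear R.
by rewrite h2; linear R.
Qed.

End Suprema.

(** * Inequalities on the support of an element *)

Section Disjoint.
Context {R : realType} {V : rieszType R}.
Implicit Types (x y z a b c d w : V) (k : R) (A : set V).

Lemma meet0_le a b c d : 0 <= a -> 0 <= c -> a <= b -> c <= d ->
  rmeet b d = 0 -> rmeet a c = 0.
Proof.
move=> a0 c0 ab cd bd; apply/le_anti; rewrite rmeet_ge0 // andbT -bd.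
exact: rmeet_le2.
Qed.

Lemma meet0D a b c : 0 <= a -> 0 <= b -> 0 <= c ->
  rmeet a c = 0 -> rmeet b c = 0 -> rmeet (a + b) c = 0.
Proof.
move=> a0 b0 c0 ac bc; apply/le_anti; rewrite rmeet_ge0 ?radd_ge0 // andbT.
by apply: le_trans (rmeetDl_le a0 b0 c0) _; rewrite ac bc addr0.
Qed.

Lemma meet0Z k a c : 0 <= k -> 0 <= a -> 0 <= c ->
  rmeet a c = 0 -> rmeet (k *: a) c = 0.
Proof.
move=> k0 a0 c0 ac.
have hn n : rmeet (n%:R *: a) c = 0.
  elim: n => [|n IHn]; first by rewrite scale0r rmeet_eql.
  rewrite -natr1 scalerDl scale1r meet0D // rscale_ge0 //.
apply: (@meet0_le _ ((Num.truncn k).+1%:R *: a) _ c); rewrite ?rscale_ge0 //.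
by apply: rscale_lel => //; apply/ltW/truncnS_gt.
Qed.

Lemma meet0_lub A s c : 0 <= s -> 0 <= c -> is_lub A s ->
  (forall a, A a -> rmeet a c = 0) -> rmeet s c = 0.
Proof.
move=> s0 c0 As Ac; apply/le_anti; rewrite rmeet_ge0 // andbT.
by apply: (rmeet_lub As) => a /Ac ->.
Qed.

(** The inequality [x <= y] after projection to the band generated by [c], in a
    form that does not mention the projection: the defect is disjoint from [c]. *)
Definition le_on c x y := rmeet (rpos (x - y)) c = 0.

Lemma le_onI c x y w : 0 <= c -> 0 <= w -> rmeet w c = 0 -> x <= y + w ->
  le_on c x y.
Proof.
move=> c0 w0 wc h; apply: (@meet0_le _ w _ c); rewrite ?rpos_ge0 ?rpos_lub //.
by apply: (rle_of h); linear R.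
Qed.

Lemma le_on_exc c x y : x <= y + rpos (x - y).
Proof. by have h := rpos_ge (x - y); apply: (rle_of h); linear R. Qed.

Lemma le_onW c x y : 0 <= c -> x <= y -> le_on c x y.
Proof.
by move=> c0 h; apply: (@le_onI _ _ _ 0); rewrite ?addr0 ?rmeet_eql.
Qed.

Lemma le_on_sub c c' x y : 0 <= c' -> c' <= c -> le_on c x y -> le_on c' x y.
Proof. by move=> c0 cc; apply: meet0_le; rewrite ?rpos_ge0. Qed.

Lemma le_onD c x y x' y' : 0 <= c -> le_on c x y -> le_on c x' y' ->
  le_on c (x + x') (y + y').
Proof.
move=> c0 h h'; apply: (@le_onI _ _ _ (rpos (x - y) + rpos (x' - y'))) => //.
- by rewrite radd_ge0 ?rpos_ge0.
- by apply: meet0D; rewrite ?rpos_ge0.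
have k := rle_add (le_on_exc c x y) (le_on_exc c x' y').
by apply: (rle_of k); linear R.
Qed.

Lemma le_on_of c a b x y : le_on c a b -> x - y = a - b -> le_on c x y.
Proof. by rewrite /le_on => h ->. Qed.

Lemma le_on_trans c y x z : 0 <= c -> le_on c x y -> le_on c y z -> le_on c x z.
Proof.
by move=> c0 h h'; apply: (le_on_of (le_onD c0 h h')); linear R.
Qed.

Lemma le_onZ c k x y : 0 <= c -> 0 <= k -> le_on c x y ->
  le_on c (k *: x) (k *: y).
Proof.
move=> c0 k0 h; apply: (@le_onI _ _ _ (k *: rpos (x - y))) => //.
- by rewrite rscale_ge0 ?rpos_ge0.
- by apply: meet0Z; rewrite ?rpos_ge0.
have k' := rscale_le k0 (le_on_exc c x y).
by apply: (rle_of k'); linear R.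
Qed.

Lemma le_on_join c x y z : 0 <= c -> le_on c x z -> le_on c y z ->
  le_on c (rjoin x y) z.
Proof.
move=> c0 h h'; apply: (@le_onI _ _ _ (rpos (x - z) + rpos (y - z))) => //.
- by rewrite radd_ge0 ?rpos_ge0.
- by apply: meet0D; rewrite ?rpos_ge0.
apply: rjoin_lub.
  have k := rle_add (le_on_exc c x z) (rpos_ge0 (y - z)).
  by apply: (rle_of k); linear R.
have k := rle_add (le_on_exc c y z) (rpos_ge0 (x - z)).
by apply: (rle_of k); linear R.
Qed.

Lemma le_onN c x y : le_on c x y -> le_on c (- y) (- x).
Proof. by move=> h; apply: (le_on_of h); linear R. Qed.

Lemma le_on_abs c x y : 0 <= c -> le_on c x y -> le_on c (- x) y ->
  le_on c (rabs x) y.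
Proof. exact: le_on_join. Qed.

Lemma le_on_lub c A s y : 0 <= c -> A !=set0 -> is_lub A s ->
  (forall a, A a -> le_on c a y) -> le_on c s y.
Proof.
move=> c0 [a0 Aa0] [s1 s2] Ay.
apply: (@meet0_lub [set rpos (a - y) | a in A]); rewrite ?rpos_ge0 //.
  split=> [_ [a Aa <-]|z zA].
    by apply: rpos_le; have h := s1 _ Aa; apply: (rle_of h); linear R.
  apply: rpos_lub; first by apply: le_trans (rpos_ge0 _) (zA _ _); exists a0.
  have h : s <= z + y.
    apply: s2 => a Aa.
    have h : a - y <= z by apply: le_trans (rpos_ge _) (zA _ _); exists a.
    by apply: (rle_of h); linear R.
  by apply: (rle_of h); linear R.
by move=> _ [a Aa <-]; apply: Ay.
Qed.

(** An inequality that fails on [c] fails on every part of the support of its own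
    defect, so a dense family of supports suffices to establish it. *)
Lemma le_on_dense c x y : 0 <= c ->
  (forall c1, 0 < c1 -> c1 <= c -> exists c2, [/\ 0 < c2, c2 <= c1 & le_on c2 x y])
  -> le_on c x y.
Proof.
move=> c0 h; rewrite /le_on; set d := rmeet _ _.
have d0 : 0 <= d by rewrite rmeet_ge0 ?rpos_ge0.
have [//|dn0] := eqVneq d 0.
have dgt : 0 < d by rewrite lt_neqAle eq_sym dn0.
have [c2 [c2gt c2d]] := h d dgt (rmeetr _ _).
rewrite /le_on rmeetC rmeet_eql => [c20|]; first by rewrite c20 ltxx in c2gt.
exact: le_trans c2d (rmeetl _ _).
Qed.

Lemma le_dense x y :
  (forall c1, 0 < c1 -> exists c2, [/\ 0 < c2, c2 <= c1 & le_on c2 x y]) -> x <= y.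
Proof.
move=> h; have : le_on (rpos (x - y)) x y.
  by apply: le_on_dense => [|c c0 _]; [exact: rpos_ge0 | exact: h].
rewrite /le_on rmeet_eql // => h'.
by have := rpos_ge (x - y); rewrite h' => k; apply: (rle_of k); linear R.
Qed.

Hypothesis dc : dedekind_complete V.

Lemma le_on_arch c x y b : 0 <= c ->
  (forall d : R, 0 < d -> le_on c x (y + d *: b)) -> le_on c x y.
Proof.
move=> c0 h; rewrite /le_on; set d := rmeet _ _.
have d0 : 0 <= d by rewrite rmeet_ge0 ?rpos_ge0.
suff h' : d <= 0 by apply/le_anti; rewrite h' d0.
apply: (@archimedean_inv _ _ _ (rpos b)) => // k k0.
have {}h : rmeet (rpos (x - (y + k *: b))) d = 0.
  by apply: (meet0_le _ _ _ _ (h k k0)); rewrite ?rpos_ge0 ?rmeetr.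
(* the part of [d] above [k b^+] is both below [d] and disjoint from it *)
have h2 : d - k *: rpos b <= rpos (x - (y + k *: b)).
  have h1 : rpos (x - y) <= rpos (x - (y + k *: b)) + k *: rpos b.
    apply: rpos_lub; first by rewrite radd_ge0 ?rpos_ge0 ?rscale_ge0 ?rpos_ge0 ?ltW.
    have h3 := rle_add (rpos_ge (x - (y + k *: b))) (rscale_le (ltW k0) (rpos_ge b)).
    by apply: (rle_of h3); linear R.
  have h3 := le_trans (rmeetl _ _ : d <= _) h1.
  by apply: (rle_of h3); linear R.
have h3 : d - k *: rpos b <= d.
  have h3 := rscale_ge0 (ltW k0) (rpos_ge0 b).
  by apply: (rle_of h3); linear R.
have := rmeet_glb h2 h3; rewrite h => h4.
by apply: (rle_of h4); linear R.
Qed.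

End Disjoint.

(** * Local values and spectral components *)

Section Spectral.
Context {R : realType} {V : rieszType R}.
Variables (dc : dedekind_complete V) (u : V) (wu : weak_order_unit u).
Implicit Types (x y z a b c d w : V) (k s t : R).

Let u0 : 0 <= u. Proof. by case: wu. Qed.

Lemma rgt0 x : 0 <= x -> x <> 0 -> 0 < x.
Proof. by move=> x0 /eqP xn0; rewrite lt_neqAle eq_sym xn0. Qed.

Lemma unit_meet_neq0 c : 0 < c -> rmeet u c <> 0.
Proof.
move=> c0 uc; have [_ /(_ c)] := wu.
rewrite rabs_id ?(ltW c0) // rmeetC => /(_ uc) c_eq0.
by rewrite c_eq0 ltxx in c0.
Qed.

Lemma le_on_unit_real c s t : 0 < c -> le_on c (s *: u) (t *: u) -> s <= t.
Proof.
move=> c0; rewrite leNgt => h; apply/negP => ts; case: (unit_meet_neq0 c0).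
have st0 : 0 < s - t by rewrite subr_gt0.
have : rmeet ((s - t) *: u) c = 0.
  by move: h; rewrite /le_on -scalerBl rpos_id // rscale_ge0 // ltW.
move=> /(meet0Z (k := (s - t)^-1)); rewrite scalerA mulVf ?gt_eqF // scale1r.
by apply; rewrite ?invr_ge0 ?rscale_ge0 // ltW.
Qed.

(** Removes the localization when the left side itself lives on [c]. *)
Lemma le_on_le (k : R) c x y : 0 <= c -> 0 <= k -> 0 <= y -> x <= k *: c ->
  le_on c x y -> x <= y.
Proof.
move=> c0 k0 y0 xc h.
have : rmeet (rpos (x - y)) (k *: c) = 0.
  by rewrite rmeetC; apply: meet0Z; rewrite ?rpos_ge0 // rmeetC.
rewrite rmeet_eql => [e|].
  by have h' := rpos_ge (x - y); rewrite e in h'; apply: (rle_of h'); linear R.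
apply: rpos_lub; first by rewrite rscale_ge0.
by apply: le_trans xc; apply: (rle_of y0); linear R.
Qed.

Lemma meet_pos_part c x y : 0 <= c -> le_on (rmeet (rpos (x - y)) c) y x.
Proof.
move=> c0; apply: (meet0_le _ _ (lexx _) (rmeetl _ _)); rewrite ?rpos_ge0 //.
  by rewrite rmeet_ge0 ?rpos_ge0.
by rewrite rmeetC -(opprB x y) rmeet_pos_neg.
Qed.

(** If [y] exceeded every multiple of the unit on [c], then [u /\ c] would be
    infinitely small. *)
Lemma bound_dense c y : 0 < c ->
  exists n c', [/\ 0 < c', c' <= c & le_on c' y (n%:R *: u)].
Proof.
move=> c0; apply: contrapT => h.
have {h} hn n : le_on c (n%:R *: u) y.
  apply: contrapT => hn; apply: h; exists n, (rmeet (rpos (n%:R *: u - y)) c).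
  split; last exact: meet_pos_part (ltW c0).
    by apply: rgt0 => //; rewrite rmeet_ge0 ?rpos_ge0 ?ltW.
  exact: rmeetr.
have : rmeet u c <= 0.
  apply: (archimedean (b := rpos y)) => // n.
  apply: (le_on_le (k := n%:R) (ltW c0)); rewrite ?rpos_ge0 //.
    by apply: rscale_le; rewrite ?rmeetr.
  apply: (le_on_trans (ltW c0) _ (le_onW (ltW c0) (rpos_ge y))).
  apply: (le_on_trans (ltW c0) _ (hn n)); apply: (le_onW (ltW c0) _).
  by apply: rscale_le; rewrite ?rmeetl.
move=> h; apply: (unit_meet_neq0 c0).
by apply/le_anti; rewrite h rmeet_ge0 // ltW.
Qed.

(** Among the numbers [- n + i d] there is a last one that [y] exceeds on some part
    of [c].  With [le_on_dense] this reduces statements about the functional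
    calculus to statements about the reals. *)
Lemma value_dense c y (d : R) : 0 < c -> 0 < d -> exists c' t,
  [/\ 0 < c', c' <= c, le_on c' (t *: u) y & le_on c' y ((t + d) *: u)].
Proof.
move=> c0 d0.
have [n [c1 [c10 c1c yn]]] := bound_dense (rabs y) c0.
have c1' := ltW c10.
pose tt i : R := - n%:R + i%:R * d.
pose P i := `[< le_on c1 y (tt i *: u) >].
have exP : exists i, P i.
  exists (Num.truncn ((n%:R + n%:R) / d)).+1; apply/asboolP.
  apply: (le_on_trans c1' (le_onW c1' (rabs_ge y)) _).
  apply: (le_on_trans c1' yn _); apply: (le_onW c1' _); apply: rscale_lel => //.
  rewrite /tt -lerBlDl opprK -ler_pdivrMr //; exact/ltW/truncnS_gt.
case: (ex_minnP exP) => -[|m] /asboolP Pm minm.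
  exists c1, (tt 0%N); split => //.
    rewrite /tt mul0r addr0; have := le_onN yn => h.
    have h1 : le_on c1 (- n%:R *: u) (- rabs y) by apply: (le_on_of h); linear R.
    apply: (le_on_trans c1' h1 _); apply: (le_onW c1' _).
    by rewrite -ropp_le opprK rabs_geN.
  apply: (le_on_trans c1' Pm _); apply: (le_onW c1' _); apply: rscale_lel => //.
  by rewrite lerDl ltW.
exists (rmeet (rpos (y - tt m *: u)) c1), (tt m); split.
- apply: rgt0; first by rewrite rmeet_ge0 ?rpos_ge0.
  move=> e; have /minm : P m by apply/asboolP.
  by rewrite ltnn.
- by apply: le_trans c1c; apply: rmeetr.
- exact: meet_pos_part.
- apply: (le_on_sub _ (rmeetr _ _)); first by rewrite rmeet_ge0 ?rpos_ge0.
  suff <- : tt m.+1 = tt m + d by [].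
  by rewrite /tt -natr1; ring.
Qed.

Lemma value_dense_ge0 c y (d : R) : 0 < c -> 0 < d -> 0 <= y -> exists c' t,
  [/\ 0 < c', c' <= c, 0 <= t, le_on c' (t *: u) y & le_on c' y ((t + d) *: u)].
Proof.
move=> c0 d0 y0; have [c' [t [c'0 c'c h1 h2]]] := value_dense y c0 d0.
have c'' := ltW c'0; exists c', (Num.max 0 t); split=> //.
- by rewrite le_max lexx.
- case: (ltP 0 t) => // _; apply: (le_onW c'' _); by rewrite scale0r.
- apply: (le_on_trans c'' h2 _); apply: (le_onW c'' _); apply: rscale_lel => //.
  by rewrite lerD2r le_max lexx orbT.
Qed.

(** In a representation with [u] as constant 1, the indicators of sets. *)
Definition component c := [/\ 0 <= c, c <= u & rmeet c (u - c) = 0].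

Lemma component_co c : component c -> 0 <= u - c.
Proof. by case=> _ cu _; rewrite rsub_ge0. Qed.

Lemma unit_le_on c d : component c -> 0 <= d -> rmeet (u - c) d = 0 ->
  le_on d u c.
Proof.
move=> cc d0 h; apply: (le_onI d0 (component_co cc) h).
by apply: (rle_of (lexx (0 : V))); linear R.
Qed.

Lemma le_on0 c d : 0 <= c -> 0 <= d -> rmeet c d = 0 -> le_on d c 0.
Proof. by move=> c0 d0 h; apply: (le_onI d0 c0 h); rewrite add0r. Qed.

Local Notation S := (spectral_comp u).

Lemma spectral_lub y t :
  is_lub [set rmeet (k%:R *: rpos (y - t *: u)) u | k in setT] (S y t).
Proof.
apply: (@supremumP _ _ _ u) => //; first by exists (rmeet (0%:R *: rpos (y - t *: u)) u), 0%N.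
by move=> _ [k _ <-]; apply: rmeetr.
Qed.

Lemma spectral_ge0 y t : 0 <= S y t.
Proof.
case: (spectral_lub y t) => h _; apply: le_trans (h _ _); last by exists 0%N.
by rewrite scale0r rmeet_ge0.
Qed.

Lemma spectral_le_unit y t : S y t <= u.
Proof. by case: (spectral_lub y t) => _; apply => _ [k _ <-]; apply: rmeetr. Qed.

Lemma spectral_disjoint y t c : 0 <= c -> rmeet (rpos (y - t *: u)) c = 0 ->
  rmeet (S y t) c = 0.
Proof.
move=> c0 h; apply: (meet0_lub _ _ (spectral_lub y t)); rewrite ?spectral_ge0 //.
move=> _ [k _ <-].
apply: (meet0_le _ c0 (rmeetl _ _) (lexx c)).
  by rewrite rmeet_ge0 ?rscale_ge0 ?rpos_ge0.
by apply: meet0Z; rewrite ?rpos_ge0.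
Qed.

Lemma spectral_gt y t : le_on (S y t) (t *: u) y.
Proof.
rewrite /le_on rmeetC; apply: spectral_disjoint; first exact: rpos_ge0.
by rewrite -(opprB y) rmeet_pos_neg.
Qed.

(** If [z] lies below both [x] and [b - sup_k (k x /\ b)], it can be added to each
    [k x /\ b] without leaving [(k + 1) x /\ b], hence to their supremum. *)
Lemma lub_multiples_disjoint x b (s : V) : 0 <= x -> s <= b ->
  is_lub [set rmeet (k%:R *: x) b | k in setT] s -> rmeet x (b - s) = 0.
Proof.
move=> x0 sb [s1 s2]; apply/le_anti/andP; split; last first.
  by rewrite rmeet_ge0 ?rsub_ge0.
set z := rmeet _ _.
have zx : z <= x := rmeetl _ _.
have zs : z <= b - s := rmeetr _ _.
have h : s <= s - z.
  apply: s2 => _ [k _ <-].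
  have h : z + rmeet (k%:R *: x) b <= rmeet (k.+1%:R *: x) b.
    apply: rmeet_glb.
      by have h := rle_add zx (rmeetl (k%:R *: x) b); apply: (rle_of h); linear R.
    have h1 : rmeet (k%:R *: x) b <= s by apply: s1; exists k.
    by have h := rle_add zs h1; apply: (rle_of h); linear R.
  have h2 : rmeet (k.+1%:R *: x) b <= s by apply: s1; exists k.+1.
  by have h3 := le_trans h h2; apply: (rle_of h3); linear R.
by apply: (rle_of h); linear R.
Qed.

Lemma spectral_le y t : le_on (u - S y t) y (t *: u).
Proof.
apply: lub_multiples_disjoint; [exact: rpos_ge0 | exact: spectral_le_unit |].
exact: spectral_lub.
Qed.

Lemma spectral_component y t : component (S y t).
Proof.
split; [exact: spectral_ge0 | exact: spectral_le_unit |].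
by apply: (spectral_disjoint _ (spectral_le y t)); rewrite rsub_ge0 spectral_le_unit.
Qed.

Lemma spectral_co_disjoint c y s t : 0 <= c -> t < s -> le_on c (s *: u) y ->
  rmeet (u - S y t) c = 0.
Proof.
move=> c0 ts h; apply: contrapT => n0.
have us0 := component_co (spectral_component y t).
have d0 : 0 < rmeet (u - S y t) c by apply: rgt0 => //; rewrite rmeet_ge0.
have h1 : le_on (rmeet (u - S y t) c) (s *: u) (t *: u).
  apply: (le_on_trans (ltW d0) (y := y)).
    by apply: (le_on_sub (ltW d0) (rmeetr _ _)).
  by apply: (le_on_sub (ltW d0) (rmeetl _ _)); apply: spectral_le.
by have := le_on_unit_real d0 h1; rewrite leNgt ts.
Qed.

Lemma spectral_homo y y' s t : s <= t -> y <= y' -> S y t <= S y' s.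
Proof.
move=> st yy; case: (spectral_lub y t) => _; apply => _ [k _ <-].
case: (spectral_lub y' s) => h _; apply: le_trans (h _ _); last by exists k.
apply: rmeet_le2 => //; apply: rscale_le => //; apply: rpos_le.
have h1 := rle_add yy (rscale_lel u0 st).
by apply: (rle_of h1); linear R.
Qed.

Lemma component_lub (A : set V) (s : V) : A !=set0 -> (forall c, A c -> component c) ->
  is_lub A s -> component s.
Proof.
move=> [c Ac] cA [s1 s2].
have s0 : 0 <= s by apply: le_trans (s1 _ Ac); case: (cA _ Ac).
have su : s <= u by apply: s2 => x /cA[].
split=> //; apply: (meet0_lub s0 _ (conj s1 s2)); first by rewrite rsub_ge0.
move=> x Ax; have [x0 xu xx] := cA _ Ax.
apply: (meet0_le x0 _ (lexx x) _ xx); first by rewrite rsub_ge0.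
by have h := s1 _ Ax; apply: (rle_of h); linear R.
Qed.

(** * Gluing along disjoint pieces *)

(** The supremum over [k] of [k c_n /\ f_n] is the projection of [f n] to the band of
    [c n]; these projections are disjoint, so lateral completeness joins them. *)
Lemma mix_pos (c f : nat -> V) : laterally_complete V -> (forall n, 0 <= c n) ->
  (forall n m, n <> m -> rmeet (c n) (c m) = 0) -> (forall n, 0 <= f n) ->
  exists g, forall n, le_on (c n) g (f n) /\ le_on (c n) (f n) g.
Proof.
move=> lc c0 cd f0.
pose A n := [set rmeet (k%:R *: c n) (f n) | k in setT].
have Alub n : is_lub (A n) (supremum 0 (A n)).
  apply: (@supremumP _ _ _ (f n)) => //; first by exists (rmeet (0%:R *: c n) (f n)), 0%N.
  by move=> _ [k _ <-]; apply: rmeetr.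
pose p n := supremum 0 (A n).
have p0 n : 0 <= p n.
  have [h _] := Alub n.
  have : rmeet (0%:R *: c n) (f n) <= p n by apply: h; exists 0%N.
  by apply: le_trans; rewrite scale0r rmeet_ge0.
have pf n : p n <= f n.
  by case: (Alub n) => _; apply => _ [k _ <-]; apply: rmeetr.
have pd n d : 0 <= d -> rmeet (c n) d = 0 -> rmeet (p n) d = 0.
  move=> d0 h; apply: (meet0_lub (p0 n) d0 (Alub n)) => _ [k _ <-].
  apply: (meet0_le _ d0 (rmeetl _ _) (lexx d)).
    by rewrite rmeet_ge0 ?rscale_ge0.
  by apply: meet0Z.
have [|||g [g1 g2]] := lc (range p).
- by exists (p 0%N), 0%N.
- by move=> _ [n _ <-].
- move=> _ _ [n _ <-] [m _ <-] nm; rewrite /disjoint_elts !rabs_id //.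
  apply: (pd) => //; rewrite rmeetC; apply: (pd) => //; apply: cd => mn.
  by apply: nm; rewrite mn.
exists g => n; split.
  apply: (le_on_lub (A := range p)) => //; first by exists (p 0%N), 0%N.
  move=> _ [m _ <-]; have [->|/eqP mn] := eqVneq m n; first exact: le_onW.
  apply: (le_on_trans (c0 n) (y := 0)); last exact: le_onW.
  by apply: le_on0 => //; apply: pd => //; apply: cd.
have pg : p n <= g by apply: g1; exists n.
apply: (le_on_trans (c0 n) (y := p n)); last exact: le_onW.
rewrite /le_on rmeetC rpos_id ?rsub_ge0 //.
exact: (lub_multiples_disjoint (c0 n) (pf n) (Alub n)).
Qed.

Lemma mix (c f : nat -> V) : laterally_complete V -> (forall n, 0 <= c n) ->
  (forall n m, n <> m -> rmeet (c n) (c m) = 0) ->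
  exists g, forall n, le_on (c n) g (f n) /\ le_on (c n) (f n) g.
Proof.
move=> lc c0 cd.
have [g gP] := mix_pos lc c0 cd (fun n => rpos_ge0 (f n)).
have [h hP] := mix_pos lc c0 cd (fun n => rpos_ge0 (- f n)).
exists (g - h) => n; have [g1 g2] := gP n; have [h1 h2] := hP n.
rewrite -{1 2}(rpos_subN (f n)); split; apply: le_onD => //; exact: le_onN.
Qed.

(** The disjoint pieces cut out by a decreasing sequence of components; piece [n]
    plays the role of the event that a stopping time equals [n]. *)
Definition piece (H : nat -> V) n := (if n is m.+1 then H m else u) - H n.

Definition vanishing (H : nat -> V) := [/\ forall n, component (H n),
  forall n, H n.+1 <= H n &
  forall c, 0 < c -> exists n c', [/\ 0 < c', c' <= c & rmeet (H n) c' = 0]].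

Section Pieces.
Variable H : nat -> V.
Hypothesis HH : vanishing H.

Let Hc n : component (H n). Proof. by case: HH. Qed.

Lemma vanishing_le m n : (m <= n)%N -> H n <= H m.
Proof.
case: HH => _ Hd _ /subnK <-; elim: (n - m)%N => // k IHk.
by rewrite addSn; apply: le_trans (Hd _) IHk.
Qed.

Lemma piece_ge0 n : 0 <= piece H n.
Proof.
by case: n => [|n]; rewrite rsub_ge0; [case: (Hc 0) | apply: vanishing_le].
Qed.

Lemma piece_co n : piece H n <= u - H n.
Proof.
case: n => [|n] //=; have [_ h _] := Hc n.
by apply: (rle_of h); rewrite /piece; linear R.
Qed.

Lemma piece_disjoint n m : n <> m -> rmeet (piece H n) (piece H m) = 0.
Proof.
have wl i j : (i < j)%N -> rmeet (piece H i) (piece H j) = 0.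
  move=> ij; rewrite rmeetC; apply: (meet0_le _ _ _ (piece_co i) (_ : rmeet (H i) _ = 0)).
  - exact: piece_ge0.
  - exact: piece_ge0.
  - case: j ij => // j ij; apply: le_trans (vanishing_le (ij : i <= j)%N).
    by have [h _ _] := Hc j.+1; apply: (rle_of h); rewrite /piece; linear R.
  - by case: (Hc i).
by case: (ltngtP n m) => // nm _; [apply: wl | rewrite rmeetC; apply: wl].
Qed.

(** The pieces up to [n] add up to [u - H n], and the [H n] vanish locally. *)
Lemma piece_dense c : 0 < c -> exists n c', [/\ 0 < c', c' <= c & c' <= piece H n].
Proof.
case: HH => _ _ Hv c0; have [n [c' [c'0 c'c hn]]] := Hv _ c0.
apply: contrapT => h.
have {}h m : rmeet (piece H m) c' = 0.
  apply: contrapT => hm; apply: h; exists m, (rmeet (piece H m) c'); split.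
  - by apply: rgt0 => //; rewrite rmeet_ge0 ?piece_ge0 ?ltW.
  - exact: le_trans (rmeetr _ _) c'c.
  - exact: rmeetl.
have {}h m : rmeet (u - H m) c' = 0.
  elim: m => [|m IHm]; first exact: h 0%N.
  suff -> : u - H m.+1 = (u - H m) + piece H m.+1.
    apply: meet0D => //; [exact: component_co | exact: piece_ge0 | exact: ltW].
  by rewrite /piece; linear R.
apply: (unit_meet_neq0 c'0).
suff -> : u = (u - H n) + H n.
  have [Hn0 _ _] := Hc n; apply: meet0D => //; last exact: ltW.
  exact: component_co.
by linear R.
Qed.

Lemma glue (f : nat -> V) : laterally_complete V ->
  exists g, forall n, le_on (piece H n) g (f n) /\ le_on (piece H n) (f n) g.
Proof.
by move=> lc; apply: mix => //; [exact: piece_ge0 | exact: piece_disjoint].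
Qed.

End Pieces.

Lemma spectral_vanishing y : vanishing (fun n => S y n%:R).
Proof.
split=> [n|n|c c0]; first exact: spectral_component.
  by apply: spectral_homo => //; rewrite ler_nat.
have [n [c' [c'0 c'c h]]] := bound_dense y c0.
by exists n, c'; split => //; apply: (spectral_disjoint _ h); apply: ltW.
Qed.

End Spectral.

(** * Powers *)

Section Real_powers.
Context {R : realType}.
Implicit Types (r p s t : R).

Lemma powR_inv_powR r s : r != 0 -> 0 <= s -> (s `^ r^-1) `^ r = s.
Proof. by move=> r0 s0; rewrite -powRrM mulVf // powRr1. Qed.

Lemma powR_powR_inv r s : r != 0 -> 0 <= s -> (s `^ r) `^ r^-1 = s.
Proof. by move=> r0 s0; rewrite -powRrM mulfV // powRr1. Qed.

Lemma powR_le r s t : 0 <= r -> 0 <= s -> s <= t -> s `^ r <= t `^ r.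
Proof.
by move=> r0 s0 st; apply: ge0_ler_powR; rewrite // nnegrE // (le_trans s0).
Qed.

Lemma powR_pred p s : 1 <= p -> 0 <= s -> s `^ (p - 1) * s = s `^ p.
Proof. by move=> p1 s0; rewrite mulrC mulr_powRB1 // (lt_le_trans ltr01). Qed.

(** Young's inequality for the exponents [p] and [p / (p - 1)], applied to [t] and
    [s ^ (p - 1)]. *)
Lemma powR_tangent p s t : 1 <= p -> 0 <= s -> 0 <= t ->
  p * s `^ (p - 1) * t - (p - 1) * s `^ p <= t `^ p.
Proof.
move=> p1 s0 t0; have p0 : 0 < p by apply: lt_le_trans p1.
have [->|pn1] := eqVneq p 1; first by rewrite subrr powRr0 !powRr1 // !mul1r mul0r subr0.
have p10 : 0 < p - 1 by rewrite subr_gt0 lt_neqAle eq_sym pn1.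
have q0 : 0 < p / (p - 1) by rewrite divr_gt0.
have h := @conjugate_powR R t (s `^ (p - 1)) p (p / (p - 1)) t0 (powR_ge0 _ _) p0 q0.
have {h} := h _; rewrite -powRrM.
have -> : (p - 1) * (p / (p - 1)) = p by field; rewrite gt_eqF.
have e : p^-1 + (p / (p - 1))^-1 = 1 by field; rewrite !gt_eqF.
move=> /(_ e) /(ler_wpM2l (ltW p0)) h; rewrite lerBlDr.
suff <- : p * (t `^ p / p + s `^ p / (p / (p - 1))) = t `^ p + (p - 1) * s `^ p.
  by apply: le_trans h; rewrite mulrAC mulrA.
by field; rewrite !gt_eqF.
Qed.

End Real_powers.

Section Powers.
Context {R : realType} {V : rieszType R}.
Variables (dc : dedekind_complete V) (lc : laterally_complete V).
Variables (u : V) (wu : weak_order_unit u).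
Implicit Types (x y z a b c d w : V) (r s t : R).

Let u0 : 0 <= u. Proof. by case: wu. Qed.

Local Notation S := (spectral_comp u).

(** The set whose supremum defines [rpow u r y]. *)
Definition steps r y := [set z | exists (n : nat) (a c : nat -> R),
    (forall i, (i < n)%N -> a i <= a i.+1 /\
       forall t, a i < t -> t <= a i.+1 -> c i <= Num.max 0 t `^ r) /\
    z = \sum_(i < n) c i *: (S y (a i) - S y (a i.+1))].

(** Where [y <= b], a step with coefficient above [b ^ r] lives on an interval beyond
    [b], hence vanishes; the remaining sum telescopes. *)
Lemma step_le r c y (b : R) z : 0 < r -> 0 <= b -> 0 <= c -> le_on c y (b *: u) ->
  steps r y z -> le_on c z (b `^ r *: u).
Proof.
move=> r0 b0 c0 yb [n [a [k [ak ->]]]]; set M := b `^ r.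
have M0 : 0 <= M := powR_ge0 _ _.
have Sge i : (i < n)%N -> 0 <= S y (a i) - S y (a i.+1).
  by move=> /ak[h _]; rewrite rsub_ge0 spectral_homo.
have term i : (i < n)%N -> le_on c (k i *: (S y (a i) - S y (a i.+1)))
    (M *: (S y (a i) - S y (a i.+1))).
  move=> iN; have [aa ki] := ak i iN.
  have [kM|Mk] := leP (k i) M; first by apply: le_onW => //; apply: rscale_lel (Sge i iN) kM.
  have [ba|ab] := leP b (a i).
    apply: (le_on_trans c0 (y := k i *: 0)).
      apply: (le_onZ c0 (le_trans M0 (ltW Mk))).
      apply: (le_on_trans c0 (y := S y (a i))).
        apply: (le_onW c0); have h := spectral_ge0 dc wu y (a i.+1).
        by apply: (rle_of h); linear R.
      apply: le_on0 => //; first exact: spectral_ge0.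
      apply: spectral_disjoint => //; apply: (le_on_trans c0 yb).
      by apply: (le_onW c0); apply: rscale_lel.
    by apply: (le_onW c0); rewrite scaler0 rscale_ge0 // Sge.
  have [-> |an] := eqVneq (a i) (a i.+1).
    by rewrite subrr !scaler0; apply: le_onW.
  have := ki (Num.min b (a i.+1)); rewrite lt_min ab ge_min lexx orbT /=.
  rewrite lt_neqAle an aa => /(_ isT isT); rewrite leNgt => /negP; case.
  apply: le_lt_trans Mk; apply: powR_le; first exact: ltW.
    by rewrite le_max lexx.
  by rewrite ge_max b0 ge_min lexx.
suff h m : (m <= n)%N -> le_on c
    (\sum_(i < m) k i *: (S y (a i) - S y (a i.+1)))
    (M *: (S y (a 0%N) - S y (a m))).
  apply: (le_on_trans c0 (h n (leqnn n))); apply: (le_onW c0); apply: rscale_le => //.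
  have h1 := spectral_le_unit dc u y (a 0%N); have h2 := spectral_ge0 dc wu y (a n).
  by apply: (rle_of (rle_add h1 h2)); linear R.
elim: m => [|m IHm] mn; first by rewrite big_ord0 subrr scaler0; apply: le_onW.
rewrite big_ord_recr /=; have := IHm (ltnW mn); set v := bigop _ _ _ => hv.
by apply: (le_on_of (le_onD c0 hv (term m mn))); linear R.
Qed.

Lemma steps0 r y : steps r y 0.
Proof.
by exists 0%N, (fun=> 0), (fun=> 0); split => //; rewrite big_ord0.
Qed.

(** Lateral completeness makes powers exist: on the piece where
    [n - 1 < y <= n] the step functions are bounded by [n ^ r], and these
    bounds glue. *)
Lemma rpow_lub r y : 0 < r -> is_lub (steps r y) (rpow u r y).
Proof.
move=> r0; have Hv := spectral_vanishing dc wu y.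
have [W Wp] := glue dc Hv (fun n => n%:R `^ r *: u) lc.
apply: (@supremumP _ _ _ W) => //; first by exists 0; apply: steps0.
move=> z zs; apply: le_dense => c c0.
have [n [c' [c'0 c'c c'p]]] := piece_dense wu Hv c0.
exists c'; split => //; apply: (le_on_sub (ltW c'0) c'p).
have p0 := piece_ge0 Hv n.
have [_ h] := Wp n; apply: (le_on_trans p0 _ h).
apply: step_le zs => //; apply: (le_on_sub p0 (piece_co Hv n)).
exact: spectral_le.
Qed.

Lemma rpow_ge0 r y : 0 < r -> 0 <= rpow u r y.
Proof. by move=> r0; case: (rpow_lub y r0) => h _; apply/h/steps0. Qed.

Lemma rpow_ub r c y (b : R) : 0 < r -> 0 <= b -> 0 <= c -> le_on c y (b *: u) ->
  le_on c (rpow u r y) (b `^ r *: u).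
Proof.
move=> r0 b0 c0 yb; apply: (le_on_lub c0 _ (rpow_lub y r0)).
  by exists 0; apply: steps0.
by move=> z; apply: step_le.
Qed.

(** One long step from just below [b] suffices, up to an arbitrarily small loss. *)
Lemma rpow_lb r c y (b : R) : 0 < r -> 0 <= b -> 0 <= c -> le_on c (b *: u) y ->
  le_on c (b `^ r *: u) (rpow u r y).
Proof.
move=> r0 b0 c0 by_; apply: (le_on_arch dc (b := u) c0) => d d0.
have rn0 : r != 0 by rewrite gt_eqF.
have w0 := rpow_ge0 y r0.
set m := Num.max 0 (b `^ r - d).
have hm : le_on c (b `^ r *: u) (m *: u + d *: u).
  by apply: (le_onW c0); rewrite -scalerDl rscale_lel // -lerBlDr le_max lexx orbT.
apply: (le_on_trans c0 hm); apply: (le_onD c0); last exact: le_onW.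
have m0 : 0 <= m by rewrite le_max lexx.
have [bm|mb] := leP (b `^ r) m.
  (* then [b = 0], since [d > 0] *)
  have -> : m = 0.
    by apply: max_l; move: bm; rewrite /m le_max => /orP[]; lra.
  by apply: le_onW; rewrite ?scale0r.
have ab : m `^ r^-1 < b.
  rewrite ltNge; apply/negP => /(powR_le (ltW r0) b0).
  by rewrite powR_inv_powR // leNgt mb.
apply: le_on_dense => // c1 c10 c1c.
have [n [c2 [c20 c2c1 yn]]] := bound_dense dc wu y c10.
exists c2; split => //; have c2' := ltW c20.
set a1 := Num.max (m `^ r^-1) n%:R.
pose z := m *: (S y (m `^ r^-1) - S y a1).
apply: (le_on_trans c2' (y := z)); last first.
  apply: (le_onW c2'); case: (rpow_lub y r0) => h _; apply: h.
  exists 1%N, (fun i => if i is 0 then m `^ r^-1 else a1), (fun=> m); split.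
    move=> [|//] _; split; first by rewrite le_max lexx.
    move=> t mt _; rewrite -[leLHS](powR_inv_powR rn0 m0).
    apply: powR_le; rewrite ?powR_ge0 ?ltW //; apply: lt_le_trans mt _.
    by rewrite le_max lexx orbT.
  by rewrite big_ord1.
apply: (le_onZ c2' m0).
have h1 : le_on c2 u (S y (m `^ r^-1)).
  apply: (unit_le_on (spectral_component dc wu y _) c2').
  apply: (spectral_co_disjoint dc wu c2' ab).
  by apply: le_on_sub by_ => //; apply: le_trans c2c1 c1c.
have h2 : le_on c2 (S y a1) 0.
  apply: (le_on0 (spectral_ge0 dc wu y a1) c2').
  apply: (spectral_disjoint dc wu c2'); apply: (le_on_trans c2' yn).
  by apply: (le_onW c2'); apply: rscale_lel => //; rewrite le_max lexx orbT.
by apply: (le_on_of (le_onD c2' h1 (le_onN h2))); linear R.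
Qed.

Lemma le_arch x y b : (forall t, 0 < t -> x <= y + t *: b) -> x <= y.
Proof.
move=> h; have : x - y <= 0.
  by apply: (archimedean_inv (b := b)) => // t t0; apply: (rle_of (h t t0)); linear R.
by move=> h'; apply: (rle_of h'); linear R.
Qed.

(** The next three comparisons relate [t ^ r] and its inverse function.  They are
    read off from local values and so avoid composing two powers. *)
Lemma rpow_root_le r x v : 0 < r -> 0 <= x -> 0 <= v ->
  rpow u r^-1 x <= v -> x <= rpow u r v.
Proof.
move=> r0 x0 v0 xv; have r'0 : 0 < r^-1 by rewrite invr_gt0.
apply: (le_arch (b := u)) => t t0; apply: le_dense => c c0.
have [c' [s [c'0 c'c s0 h1 h2]]] := value_dense_ge0 dc wu c0 t0 x0.
exists c'; split => //; have c'' := ltW c'0.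
have h3 := le_on_trans c'' (rpow_lb r'0 s0 c'' h1) (le_onW c'' xv).
have h4 := rpow_lb r0 (powR_ge0 _ _) c'' h3.
rewrite powR_inv_powR ?gt_eqF // in h4.
apply: (le_on_trans c'' h2).
apply: (le_on_of (le_onD c'' h4 (le_onW c'' (lexx (t *: u))))); linear R.
Qed.

Lemma root_le_rpow r x v : 0 < r -> 0 <= x -> 0 <= v ->
  x <= rpow u r v -> rpow u r^-1 x <= v.
Proof.
move=> r0 x0 v0 xv; have r'0 : 0 < r^-1 by rewrite invr_gt0.
apply: (le_arch (b := u)) => t t0; apply: le_dense => c c0.
have [c' [s [c'0 c'c s0 h1 h2]]] := value_dense_ge0 dc wu c0 t0 v0.
exists c'; split => //; have c'' := ltW c'0.
have st0 : 0 <= s + t by rewrite addr_ge0 // ltW.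
have h3 := le_on_trans c'' (le_onW c'' xv) (rpow_ub r0 st0 c'' h2).
have h4 := rpow_ub r'0 (powR_ge0 _ _) c'' h3.
rewrite powR_powR_inv ?gt_eqF // in h4.
apply: (le_on_trans c'' h4).
apply: (le_on_of (le_onD c'' h1 (le_onW c'' (lexx (t *: u))))); linear R.
Qed.

Lemma rpow_ge_root r c v t : 0 < r -> 0 <= t -> 0 <= c -> 0 <= v ->
  le_on c (t *: u) (rpow u r v) -> le_on c (t `^ r^-1 *: u) v.
Proof.
move=> r0 t0 c0 v0 h; have r'0 : 0 < r^-1 by rewrite invr_gt0.
apply: (le_on_arch dc (b := u) c0) => d d0; apply: le_on_dense => // c1 c10 c1c.
have [c' [s [c'0 c'c s0 h1 h2]]] := value_dense_ge0 dc wu c10 d0 v0.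
exists c'; split => //; have c'' := ltW c'0.
have sd0 : 0 <= s + d by rewrite addr_ge0 // ltW.
have h3 := le_on_sub c'' (le_trans c'c c1c) h.
have := le_on_unit_real wu c'0 (le_on_trans c'' h3 (rpow_ub r0 sd0 c'' h2)).
move=> /(powR_le (ltW r'0) t0); rewrite powR_powR_inv ?gt_eqF // => h4.
apply: (le_on_trans c'' (le_onW c'' (rscale_lel u0 h4))).
apply: (le_on_of (le_onD c'' h1 (le_onW c'' (lexx (d *: u))))); linear R.
Qed.

(** * Convexity of powers *)

Section Convex.
Variables (p : R) (p1 : 1 <= p).

Let p0 : 0 < p. Proof. exact: lt_le_trans p1. Qed.

Definition slope s : R := p * s `^ (p - 1).
Definition intercept s : R := (p - 1) * s `^ p.
Definition tangent s y := slope s *: y - intercept s *: u.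

Lemma slope_ge0 s : 0 <= slope s.
Proof. by rewrite mulr_ge0 ?powR_ge0 // ltW. Qed.

Lemma intercept_ge0 s : 0 <= intercept s.
Proof. by rewrite mulr_ge0 ?powR_ge0 // subr_ge0. Qed.

(** For an exponent [p >= 1] the power of [y] is the supremum of the tangents
    to [t ^ p] evaluated at [y].  Since these are affine and increasing in [y],
    monotonicity, convexity and continuity along suprema follow at once. *)
Lemma tangent_le_rpow s y : 0 <= s -> 0 <= y -> tangent s y <= rpow u p y.
Proof.
move=> s0 y0; apply: (le_arch (b := u)) => t t0; apply: le_dense => c c0.
set al := slope s; have al0 : 0 <= al := slope_ge0 s.
have d0 : 0 < t / (al + 1) by rewrite divr_gt0 // ltr_wpDl.
have [c' [v [c'0 c'c v0 h1 h2]]] := value_dense_ge0 dc wu c0 d0 y0.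
exists c'; split => //; have c'' := ltW c'0.
have h3 := rpow_lb p0 v0 c'' h1.
have h4 := le_onZ c'' al0 h2.
have h5 : (al * (v + t / (al + 1)) - intercept s) *: u <= (v `^ p + t) *: u.
  apply: rscale_lel => //.
  have h : al * v - intercept s <= v `^ p := powR_tangent p1 s0 v0.
  have h' : al * (t / (al + 1)) <= t.
    rewrite mulrA ler_pdivrMr ?ltr_wpDl // mulrDr mulr1 mulrC; lra.
  by rewrite mulrDr; lra.
have h6 := le_onD c'' (le_onD c'' h3 h4) (le_onW c'' h5).
by apply: (le_on_of h6); rewrite /tangent -/al; linear R.
Qed.

(** Where [v <= y <= v + d], the tangent at [v + d] loses at most [slope * d]; the slopes
    are bounded where [y] is. *)
Lemma rpow_le_tangents c y w : 0 <= c -> 0 <= y ->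
  (forall s, 0 <= s -> le_on c (tangent s y) w) -> le_on c (rpow u p y) w.
Proof.
move=> c0 y0 h; apply: (le_on_arch dc (b := u) c0) => t t0.
apply: le_on_dense => // c1 c10 c1c.
have [n [c2 [c20 c2c1 yn]]] := bound_dense dc wu y c10.
pose K := slope (n%:R + 1).
have K0 : 0 <= K := slope_ge0 _.
pose d := Num.min 1 (t / (K + 1)).
have d0 : 0 < d by rewrite lt_min ltr01 divr_gt0 // ltr_wpDl.
have d1 : d <= 1 by rewrite ge_min lexx.
have Kd : K * d <= t.
  have : K * d <= K * (t / (K + 1)) by rewrite ler_wpM2l // ge_min lexx orbT.
  move=> /le_trans; apply.
  by rewrite mulrA ler_pdivrMr ?ltr_wpDl // mulrDr mulr1 mulrC; lra.
have [c' [v [c'0 c'c v0 h1 h2]]] := value_dense_ge0 dc wu c20 d0 y0.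
have c'' := ltW c'0; exists c'; split => //; first exact: le_trans c'c c2c1.
have vn : v <= n%:R.
  apply: (le_on_unit_real wu c'0); apply: (le_on_trans c'' h1).
  exact: le_on_sub yn.
have s0 : 0 <= v + d by rewrite addr_ge0 // ltW.
set s := v + d in h2 s0.
have h3 := rpow_ub p0 s0 c'' h2.
have h4 := le_onZ c'' (slope_ge0 s) h1.
have h5 := le_on_sub c'' (le_trans c'c (le_trans c2c1 c1c)) (h s s0).
have h6 : s `^ p *: u <= (slope s * v - intercept s + t) *: u.
  apply: rscale_lel => //.
  have e : slope s * s - intercept s = s `^ p.
    by rewrite /slope /intercept -mulrA powR_pred //; ring.
  have sK : slope s <= K.
    apply: ler_wpM2l; first exact: ltW.
    by apply: powR_le; rewrite ?subr_ge0 //; apply: lerD.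
  have h7 : slope s * d <= t by apply: le_trans Kd; rewrite ler_wpM2r // ltW.
  have e2 : slope s * s = slope s * v + slope s * d by rewrite /s mulrDr.
  by lra.
have h7 := le_onD c'' (le_onD c'' h3 h4) (le_onD c'' h5 (le_onW c'' h6)).
by apply: (le_on_of h7); rewrite /tangent; linear R.
Qed.

Lemma rpow_homo_on c x y : 0 <= c -> 0 <= x -> 0 <= y -> le_on c x y ->
  le_on c (rpow u p x) (rpow u p y).
Proof.
move=> c0 x0 y0 xy; apply: rpow_le_tangents => // s s0.
apply: (le_on_trans c0 _ (le_onW c0 (tangent_le_rpow s0 y0))).
by apply: (le_on_of (le_onZ c0 (slope_ge0 s) xy)); rewrite /tangent; linear R.
Qed.

Lemma rpow_le_tangents_le y w : 0 <= y ->
  (forall s, 0 <= s -> tangent s y <= w) -> rpow u p y <= w.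
Proof.
move=> y0 h; apply: le_dense => c c0; exists c; split => //; have c'' := ltW c0.
by apply: rpow_le_tangents => // s s0; apply: le_onW => //; apply: h.
Qed.

Lemma rpow_homo x y : 0 <= x -> x <= y -> rpow u p x <= rpow u p y.
Proof.
move=> x0 xy; apply: le_dense => c c0; exists c; split => //; have c'' := ltW c0.
by apply: rpow_homo_on => //; [exact: le_trans xy | exact: le_onW].
Qed.

(** Each tangent is affine and increasing, hence compatible with suprema. *)
Lemma rpow_lub_le (A : set V) x w : A !=set0 -> is_lub A x ->
  (forall a, A a -> 0 <= a) -> (forall a, A a -> rpow u p a <= w) ->
  rpow u p x <= w.
Proof.
move=> [a0 Aa0] [x1 x2] A0 Aw.
have x0 : 0 <= x := le_trans (A0 _ Aa0) (x1 _ Aa0).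
apply: rpow_le_tangents_le => // s s0; set al := slope s.
have h a : A a -> al *: a <= w + intercept s *: u.
  move=> Aa; have h := le_trans (tangent_le_rpow s0 (A0 _ Aa)) (Aw _ Aa).
  by apply: (rle_of h); rewrite /tangent -/al; linear R.
suff h' : al *: x <= w + intercept s *: u.
  by apply: (rle_of h'); rewrite /tangent -/al; linear R.
have [al0|aln0] := eqVneq al 0.
  by have := h _ Aa0; rewrite al0 !scale0r.
have alp : 0 <= al^-1 by rewrite invr_ge0 slope_ge0.
have h2 : x <= al^-1 *: (w + intercept s *: u).
  apply: x2 => a /h /(rscale_le alp); rewrite scalerA mulVf // scale1r.
  by [].
have := rscale_le (slope_ge0 s) h2.
by rewrite -/al scalerA mulfV // scale1r.
Qed.

(** Homogeneity applied to the tangent at [s l].  The factor [l] of the intercept is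
    what lets the intercepts add up in a convex combination. *)
Lemma tangent_scaled l s d : 0 < l -> 0 <= s -> 0 <= d ->
  slope s *: d - (l * intercept s) *: u <= l `^ (1 - p) *: rpow u p d.
Proof.
move=> l0 s0 d0; have l0' := ltW l0.
have sl0 : 0 <= s * l by rewrite mulr_ge0.
have h := rscale_le (powR_ge0 l (1 - p)) (tangent_le_rpow sl0 d0).
have e1 : l `^ (1 - p) * slope (s * l) = slope s.
  have -> : 1 - p = - (p - 1) by ring.
  rewrite /slope powRM // powRN; field.
  by rewrite gt_eqF // powR_gt0.
have e2 : l `^ (1 - p) * intercept (s * l) = l * intercept s.
  have -> : 1 - p = - (p - 1) by ring.
  rewrite /intercept powRM // powRN -(powR_pred p1 l0').
  by field; rewrite gt_eqF // powR_gt0.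
apply: le_trans h; rewrite /tangent -e1 -e2.
by apply: (rle_of (lexx (0 : V))); linear R.
Qed.

(** Jensen's inequality for the combination of the [d i / l i] with weights [l i]. *)
Lemma rpow_sum_le (l : nat -> R) (d : nat -> V) n : (forall i, 0 < l i) ->
  \sum_(i < n) l i <= 1 -> (forall i, 0 <= d i) ->
  rpow u p (\sum_(i < n) d i) <= \sum_(i < n) l i `^ (1 - p) *: rpow u p (d i).
Proof.
move=> l0 l1 d0; apply: rpow_le_tangents_le => [|s s0]; first exact: rsum_ge0.
have h : slope s *: (\sum_(i < n) d i) - ((\sum_(i < n) l i) * intercept s) *: u <=
    \sum_(i < n) l i `^ (1 - p) *: rpow u p (d i).
  elim: n {l1} => [|n IHn]; first by rewrite !big_ord0 mul0r scale0r scaler0 subrr.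
  rewrite !big_ord_recr /=; move: IHn.
  set a := bigop _ _ _; set b := bigop _ _ _; set c := bigop _ _ _ => h.
  by apply: (rle_of (rle_add h (tangent_scaled (l0 n) s0 (d0 n)))); linear R.
apply: le_trans h; rewrite /tangent.
have h : (\sum_(i < n) l i) * intercept s <= intercept s.
  by rewrite ler_piMl // intercept_ge0.
by apply: (rle_of (rscale_lel u0 h)); linear R.
Qed.

Lemma rpowD_le x y : 0 <= x -> 0 <= y ->
  rpow u p (x + y) <= 2^-1 `^ (1 - p) *: (rpow u p x + rpow u p y).
Proof.
move=> x0 y0; have := @rpow_sum_le (fun=> 2^-1) (fun i => if i is 0 then x else y) 2.
rewrite !big_ord_recr !big_ord0 /= !add0r scalerDr; apply=> [_||[|i]] //; first by rewrite invr_gt0.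
lra.
Qed.

Lemma le_rpow_unit x : 0 <= x -> x <= rpow u p x + u.
Proof.
move=> x0; have := tangent_le_rpow ler01 x0.
rewrite /tangent /slope /intercept !powR1 !mulr1 => h.
have p'0 : 0 <= p^-1 by rewrite invr_ge0 ltW.
have p'1 : p^-1 <= 1 by rewrite invf_le1.
have h2 := rscale_le p'0 h.
have h3 := rscale_lel (rpow_ge0 x p0) p'1.
have h4 := rscale_lel u0 (ltac:(lra) : 1 - p^-1 <= 1).
apply: (rle_of (rle_add h2 (rle_add h3 h4))).
by linear_with R ltac:(try field; rewrite ?gt_eqF //).
Qed.

End Convex.
End Powers.

(** * Suprema of multiples and of truncations *)

Section Suprema_more.
Context {R : realType} {V : rieszType R}.
Implicit Types (x y z : V) (A : set V).

Lemma lub_scale A s (k : R) : 0 <= k -> A !=set0 -> is_lub A s ->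
  is_lub [set k *: a | a in A] (k *: s).
Proof.
move=> k0 [a0 Aa0] [s1 s2]; split => [_ [a Aa <-]|z zA].
  by apply: rscale_le => //; apply: s1.
have [k_eq0|kn0] := eqVneq k 0.
  by have := zA _ (imageP _ Aa0); rewrite k_eq0 !scale0r.
have k'0 : 0 <= k^-1 by rewrite invr_ge0.
have h : s <= k^-1 *: z.
  apply: s2 => a Aa; have := rscale_le k'0 (zA _ (imageP _ Aa)).
  by rewrite scalerA mulVf // scale1r.
by have := rscale_le k0 h; rewrite scalerA mulfV // scale1r.
Qed.

Lemma lub_meet (I : Type) (x : I -> V) s a : a <= s -> is_lub (range x) s ->
  is_lub (range (fun i => rmeet a (x i))) a.
Proof.
move=> as_ xs; split => [_ [i _ <-]|z zA]; first exact: rmeetl.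
rewrite -(rmeet_eql as_) rmeetC; apply: (rmeet_lub xs) => _ [i _ <-].
by rewrite rmeetC; apply: zA; exists i.
Qed.

Lemma rsub_meet x y : x - rmeet x y = rpos (x - y).
Proof.
have h := radd_join_meet x y.
have e : rjoin x y = rpos (x - y) + y by rewrite /rpos -rjoinD; congr rjoin; linear R.
transitivity (x + y - rmeet x y - y); first by linear R.
by rewrite -h e; linear R.
Qed.

Lemma unit_lub u x : dedekind_complete V -> weak_order_unit u -> 0 <= x ->
  is_lub (range (fun k : nat => rmeet x (k%:R *: u))) x.
Proof.
move=> dc wu x0; split => [_ [k _ <-]|z zA]; first exact: rmeetl.
apply: le_dense => c c0; have [n [c' [c'0 c'c h]]] := bound_dense dc wu x c0.
exists c'; split => //; have c'' := ltW c'0.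
apply: (le_on_trans c'' (y := rmeet x (n%:R *: u))); last first.
  by apply: (le_onW c''); apply: zA; exists n.
by rewrite /le_on rsub_meet rpos_id // rpos_ge0.
Qed.

End Suprema_more.

(** * The embedding into the universal completion *)

Section Conditional_expectation.
Context {R : realType} {E Eu : rieszType R}.
Variables (e : E) (T : {linear E -> E}) (iota : {linear E -> Eu}).
Hypotheses (hT : cond_riesz_triple e T) (hEu : universal_completion iota).
Implicit Types (a b : E) (x y z w W : Eu).

Let dcE : dedekind_complete E. Proof. by case: hT. Qed.
Let dc : dedekind_complete Eu. Proof. by case: hEu. Qed.
Let lc : laterally_complete Eu. Proof. by case: hEu. Qed.

Local Notation u := (iota e).

Let iotaD a b : iota (a + b) = iota a + iota b. Proof. exact: raddfD. Qed.
Let iotaB a b : iota (a - b) = iota a - iota b. Proof. exact: raddfB. Qed.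
Let iotaZ (k : R) a : iota (k *: a) = k *: iota a. Proof. exact: linearZ. Qed.
Let iota0 : iota 0 = 0. Proof. exact: raddf0. Qed.
Let TD' a b : T (a + b) = T a + T b. Proof. exact: raddfD. Qed.
Let TB a b : T (a - b) = T a - T b. Proof. exact: raddfB. Qed.
Let TZ (k : R) a : T (k *: a) = k *: T a. Proof. exact: linearZ. Qed.
Let T0 : T 0 = 0. Proof. exact: raddf0. Qed.

Lemma iota_dense x : 0 < x -> exists2 a, 0 < a & iota a <= x.
Proof. by case: hEu => _ _ _ _; apply. Qed.

Lemma iota_le a b : (iota a <= iota b) = (a <= b).
Proof.
case: hEu => _ _ inj ij _; apply/idP/idP => h.
  suff <- : rjoin a b = b by exact: rjoinl.
  apply: inj; rewrite ij; apply/le_anti; rewrite rjoinr rjoin_lub //.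
suff -> : b = rjoin a b by rewrite ij rjoinl.
by apply/le_anti; rewrite rjoinr rjoin_lub.
Qed.

Lemma iota_ge0 a : (0 <= iota a) = (0 <= a).
Proof. by rewrite -iota_le iota0. Qed.

Lemma iota_meet a b : iota (rmeet a b) = rmeet (iota a) (iota b).
Proof.
case: hEu => _ _ _ ij _.
have h1 := radd_join_meet a b; have h2 := radd_join_meet (iota a) (iota b).
transitivity (iota (a + b) - iota (rjoin a b)).
  by rewrite -h1 iotaD; linear R.
by rewrite ij iotaD -h2; linear R.
Qed.

(** A smaller bound of the image would leave room for the image of some [x > 0],
    by order density, and then [s - x] would bound [A]. *)
Lemma iota_lub (A : set E) s : is_lub A s -> is_lub (iota @` A) (iota s).
Proof.
move=> [s1 s2]; split => [_ [a Aa <-]|v vA]; first by rewrite iota_le s1.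
have [h|/eqP n0] := eqVneq (iota s - rmeet (iota s) v) 0.
  have -> : iota s = rmeet (iota s) v.
    by rewrite -[RHS]add0r -h; linear R.
  exact: rmeetr.
have d0 : 0 < iota s - rmeet (iota s) v.
  by apply: rgt0 n0; rewrite rsub_ge0 rmeetl.
have [x x0 xd] := iota_dense d0.
have h : s <= s - x.
  apply: s2 => a Aa; rewrite -iota_le iotaB.
  have h : iota a <= rmeet (iota s) v.
    by apply: rmeet_glb; [rewrite iota_le s1 | apply: vA; exists a].
  by apply: (rle_of (rle_add h xd)); linear R.
have : x <= 0 by apply: (rle_of h); linear R.
by rewrite lt_geF.
Qed.

Definition below x := [set a | 0 <= a /\ iota a <= x].

(** If [v] bounds these elements without being above [x], there is [a > 0] with
    [iota a] below the gap; all multiples of [a] then stay below [x]. *)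
Lemma below_lub x : 0 <= x -> is_lub (iota @` below x) x.
Proof.
move=> x0; split => [_ [a [_ ax] <-] //|v vA].
have [h|/eqP n0] := eqVneq (x - rmeet x v) 0.
  have -> : x = rmeet x v by rewrite -[RHS]add0r -h; linear R.
  exact: rmeetr.
have d0 : 0 < x - rmeet x v by apply: rgt0 n0; rewrite rsub_ge0 rmeetl.
have [a a0 ad] := iota_dense d0.
have h n : below x (n%:R *: a).
  elim: n => [|n [h0 IHn]]; first by split; rewrite scale0r ?iota0.
  split; first by rewrite rscale_ge0 // ltW.
  have h : iota (n%:R *: a) <= rmeet x v.
    by apply: rmeet_glb => //; apply: vA; exists (n%:R *: a).
  have := rle_add h ad; rewrite -natr1 scalerDl scale1r iotaD => h'.
  by apply: (rle_of h'); linear R.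
have : iota a <= 0.
  apply: (archimedean (b := x) dc) => n; rewrite -iotaZ.
  by case: (h n).
by rewrite -iota0 iota_le lt_geF.
Qed.

(** [x] is the supremum of the elements of [E] below it, which exists in [E]. *)
Lemma iota_ideal a x : 0 <= x -> x <= iota a -> exists b, iota b = x.
Proof.
move=> x0 xa; have [|b [_ h]|b hb] := @lub_exists _ _ (below x) a dcE.
- by exists 0; split; rewrite ?iota0.
- by rewrite -iota_le (le_trans h).
by exists b; apply: lub_unique (iota_lub hb) (below_lub x0).
Qed.

Lemma unit_ge0 : 0 <= e. Proof. by case: hT => _ []. Qed.

Lemma iota_unit : weak_order_unit u.
Proof.
split=> [|x xu]; first by rewrite iota_ge0 unit_ge0.
suff h : rabs x = 0.
  apply/le_anti; have := rabs_ge x; have := rabs_geN x; rewrite h => h1 ->.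
  by apply: (rle_of h1); linear R.
apply: contrapT => n0; have [a a0 ax] := iota_dense (rgt0 (rabs_ge0 x) n0).
case: hT => _ [_ /(_ a) ea] _; move: (a0); rewrite ea ?ltxx //.
case: hEu => _ _ inj _ _; apply: inj; rewrite iota_meet iota0.
rewrite (rabs_id (ltW a0)); apply: (meet0_le _ _ ax (lexx u) xu); rewrite iota_ge0.
  exact: ltW.
exact: unit_ge0.
Qed.

Let wu := iota_unit.
Let u0 : 0 <= u. Proof. by case: wu. Qed.

(** * The operator on the small space *)

Lemma T_ge0 a : 0 <= a -> 0 <= T a.
Proof.
rewrite le_eqVlt => /predU1P[<-|a0]; first by rewrite T0.
by case: hT => _ _ [_ Tp _ _ _]; apply/ltW/Tp.
Qed.

Lemma T_le a b : a <= b -> T a <= T b.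
Proof. by rewrite -rsub_ge0 => /T_ge0; rewrite TB rsub_ge0. Qed.

Lemma T_idem a : T (T a) = T a.
Proof. by case: hT => _ _ [_ _ -> _ _]. Qed.

(** The differences [s - xs i] witness the order convergence of [xs] to [s]; order
    continuity is applied to that. *)
Lemma T_lub (I : Type) (le : I -> I -> Prop) (xs : I -> E) s :
  directed le -> (forall i j, le i j -> xs i <= xs j) -> is_lub (range xs) s ->
  is_lub (range (T \o xs)) (T s).
Proof.
move=> dI xle [s1 s2]; have xs_le i : xs i <= s by apply: s1; exists i.
case: hT => _ _ [oc _ _ _ _].
have [|J [leJ [v [_ [_ _ [_ vinf]] hv]]]] := oc I le xs s dI.
  exists I, le, (fun i => s - xs i); split => //.
    split=> // [i j /xle h|]; first by apply: (rle_of h); linear R.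
    split; first by split => // _ [i _ <-]; rewrite rsub_ge0.
    move=> b [_ hb]; have h : s <= s - b.
      apply: s2 => _ [i _ <-]; have h : b <= s - xs i by apply: hb; exists i.
      by apply: (rle_of h); linear R.
    by apply: (rle_of h); linear R.
  move=> j; exists j => i /xle h; rewrite rabs_distC rabs_id ?rsub_ge0 //.
  by apply: (rle_of h); linear R.
split=> [_ [i _ <-]|b hb]; first by apply: T_le.
have h : T s - b <= 0.
  apply: vinf; split => // _ [j _ <-]; have [i hi] := hv j.
  case: dI => _ refl _ _; apply: le_trans (hi i (refl i)).
  have h1 : T (xs i) <= b by apply: hb; exists i.
  by apply: le_trans (rabs_geN _); apply: (rle_of h1) => /=; linear R.
by apply: (rle_of h); linear R.
Qed.

(** * The operator on the positive part of the domain *)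

(** [x] lies in the domain and its image is at most [W]; equivalently, [W] bounds
    the images of the elements of the small space below [x].  The extension can
    be computed from this canonical net instead of arbitrary ones. *)
Definition dominated x W := 0 <= x /\ forall a, below x a -> iota (T a) <= W.

(** The value of the extension at [x] is [z]; see [TD_extends]. *)
Definition extends x z := 0 <= x /\ is_lub [set iota (T a) | a in below x] z.

Lemma below0 x : 0 <= x -> below x 0.
Proof. by split; rewrite ?iota0. Qed.

(** An element [a] of [E] below [x] is the supremum of the [a /\ xs i], so [T a] is
    controlled by the [T (xs i)]: every net gives the same value. *)
Lemma net_dominated (I : Type) (le : I -> I -> Prop) (xs : I -> E) x W :
  directed le -> (forall i j, le i j -> xs i <= xs j) -> (forall i, 0 <= xs i) ->
  is_lub (range (iota \o xs)) x -> (forall i, iota (T (xs i)) <= W) ->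
  dominated x W.
Proof.
move=> dI xle xs0 xsx TW; have [x1 _] := xsx.
have xi i : iota (xs i) <= x by apply: x1; exists i.
split; first by case: dI => -[i] _ _ _; apply: le_trans (xi i); rewrite iota_ge0.
move=> a [a0 ax].
have ha : is_lub (range (fun i => rmeet a (xs i))) a.
  have [h1 h2] := lub_meet ax xsx.
  split=> [_ [i _ <-]|b hb]; first exact: rmeetl.
  rewrite -iota_le; apply: h2 => _ [i _ <-] /=; rewrite -iota_meet iota_le.
  by apply: hb; exists i.
have xle' i j : le i j -> rmeet a (xs i) <= rmeet a (xs j).
  by move=> /xle; apply: rmeet_le2.
have [_] := iota_lub (T_lub dI xle' ha).
apply=> _ [_ [i _ <-] <-] /=; apply: le_trans (TW i).
by rewrite iota_le T_le // rmeetr.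
Qed.

Definition below_le x (i j : {a : E | below x a}) := sval i <= sval j.

Lemma below_directed x : 0 <= x ->
  directed (@below_le x).
Proof.
move=> x0; split=> //.
- by constructor; exists 0; apply: below0.
- by move=> a; apply: lexx.
- by move=> a b c; apply: le_trans.
move=> [a [a0 ax]] [b [b0 bx]]; have hj : below x (rjoin a b).
  split; first by apply: le_trans a0 _; apply: rjoinl.
  by case: hEu => _ _ _ -> _; apply: rjoin_lub.
by exists (exist _ _ hj); split; [exact: rjoinl | exact: rjoinr].
Qed.

Lemma below_net x W : dominated x W -> dom_net iota T
  (@below_le x) sval x.
Proof.
move=> [x0 xW]; split=> //; first exact: below_directed.
- by case=> a [].
- have [h1 h2] := below_lub x0; split => [_ [[a ax] _ <-]|z hz].
    by apply: h1; exists a.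
  by apply: h2 => _ [a ax <-]; apply: hz; exists (exist _ a ax).
split; last by exists W => _ [[a ax] _ <-]; apply: xW.
by exists 0 => _ [[a [a0 ax]] _ <-]; rewrite /= iota_ge0 T_ge0.
Qed.

Lemma domD_dominated x : domD iota T x <-> exists W, dominated x W.
Proof.
split=> [[I [le [xs [dI xle xs0 xsx [_ [W hW]]]]]]|[W xW]].
  exists W; apply: (net_dominated dI xle xs0 xsx) => i.
  by apply: hW; exists i.
exists {a : E | below x a}, (@below_le x), sval.
exact: below_net xW.
Qed.

Lemma extends_dominated x z : extends x z -> dominated x z.
Proof. by case=> x0 [h _]; split => // a ax; apply: h; exists a. Qed.

Lemma extends_le x z W : extends x z -> dominated x W -> z <= W.
Proof. by case=> x0 [_ h] [_ hW]; apply: h => _ [a ax <-]; apply: hW. Qed.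

Lemma TD_extends x z : TD iota T x z <-> extends x z.
Proof.
split=> [[I [le [xs [[dI xle xs0 xsx _] [z1 z2]]]]]|[x0 [z1 z2]]].
  have [x0 xz] : dominated x z.
    by apply: (net_dominated dI xle xs0 xsx) => i; apply: z1; exists i.
  split=> //; split => [_ [a ax <-]|w hw]; first exact: xz.
  apply: z2 => _ [i _ <-]; apply: hw; exists (xs i) => //.
  by split => //; case: xsx => h _; apply: h; exists i.
exists {a : E | below x a}, (@below_le x), sval; split.
  by apply: (@below_net x z); split => // a ax; apply: z1; exists a.
split=> [_ [[a ax] _ <-]|w hw]; first by apply: z1; exists a.
by apply: z2 => _ [a ax <-]; apply: hw; exists (exist _ a ax).
Qed.

Lemma dominated_extends x W : dominated x W -> exists z, extends x z.
Proof.
move=> [x0 xW].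
have [||z hz] := @lub_exists _ _ [set iota (T a) | a in below x] W dc.
- by exists (iota (T 0)), 0 => //; apply: below0.
- by move=> _ [a ax <-]; apply: xW.
by exists z.
Qed.

Lemma extends_unique x z w : extends x z -> extends x w -> z = w.
Proof. by move=> [_ h] [_ h']; apply: lub_unique h h'. Qed.

Lemma extends_ge0 x z : extends x z -> 0 <= z.
Proof.
move=> [x0 [h _]]; apply: le_trans (h (iota (T 0)) _); first by rewrite T0 iota0.
by exists 0 => //; apply: below0.
Qed.

Lemma dominated_le x y W W' : 0 <= x -> x <= y -> W <= W' -> dominated y W ->
  dominated x W'.
Proof.
move=> x0 xy WW [_ yW]; split=> // a [a0 ax]; apply: le_trans WW.
by apply: yW; split => //; apply: le_trans xy.
Qed.

Lemma extendsD x y z w : extends x z -> extends y w -> extends (x + y) (z + w).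
Proof.
move=> hx hy; have [x0 [z1 z2]] := hx; have [y0 [w1 w2]] := hy.
split; first exact: radd_ge0.
split=> [_ [a [a0 axy] <-]|v hv].
  (* Riesz decomposition of [iota a] *)
  have a0' : 0 <= iota a by rewrite iota_ge0.
  have [b hb] := iota_ideal (rmeet_ge0 a0' x0) (rmeetl (iota a) x).
  have b0 : 0 <= b by rewrite -iota_ge0 hb rmeet_ge0.
  have ba : b <= a by rewrite -iota_le hb rmeetl.
  have -> : a = b + (a - b) by linear R.
  rewrite TD' iotaD; apply: rle_add; [apply: z1; exists b | apply: w1; exists (a - b)] => //.
    by split; rewrite // hb rmeetr.
  split; first by rewrite rsub_ge0.
  rewrite iotaB hb rsub_meet; apply: rpos_lub => //.
  by apply: (rle_of axy); linear R.
have h : z <= v - w.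
  apply: z2 => _ [a [a0 ax] <-].
  have h : w <= v - iota (T a).
    apply: w2 => _ [b [b0 bx] <-].
    have h : iota (T (a + b)) <= v.
      apply: hv; exists (a + b) => //; split; first exact: radd_ge0.
      by rewrite iotaD rle_add.
    by rewrite TD' iotaD in h; apply: (rle_of h); linear R.
  by apply: (rle_of h); linear R.
by apply: (rle_of h); linear R.
Qed.

Lemma extendsZ (k : R) x z : 0 <= k -> extends x z -> extends (k *: x) (k *: z).
Proof.
move=> k0 [x0 hz]; split; first exact: rscale_ge0.
have [z1 z2] := lub_scale k0 (ex_intro _ _ (imageP _ (below0 x0))) hz.
have [k_eq0|kn0] := eqVneq k 0.
  rewrite k_eq0 !scale0r; split => [_ [a [a0 ax] <-]|w hw].
    have : T a <= T 0 by apply: T_le; rewrite -iota_le iota0.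
    by rewrite T0 -iota_le iota0.
  by apply: hw; exists 0; rewrite ?T0 ?iota0 //; apply: below0.
have k'0 : 0 <= k^-1 by rewrite invr_ge0.
split=> [_ [a [a0 ax] <-]|w hw].
  apply: z1; exists (iota (T (k^-1 *: a))); last by rewrite -iotaZ -TZ scalerA mulfV // scale1r.
  exists (k^-1 *: a) => //; split; first exact: rscale_ge0.
  rewrite iotaZ; have := rscale_le k'0 ax.
  by rewrite scalerA mulVf // scale1r.
apply: z2 => _ [_ [a [a0 ax] <-] <-]; apply: hw; exists (k *: a); last by rewrite TZ iotaZ.
by split; rewrite ?rscale_ge0 // iotaZ rscale_le.
Qed.

Lemma extends_iota a : 0 <= a -> extends (iota a) (iota (T a)).
Proof.
move=> a0; split; first by rewrite iota_ge0.
split=> [_ [b [b0 ba] <-]|w]; last by apply; exists a.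
by rewrite iota_le T_le // -iota_le.
Qed.

(** The image under [T] of the canonical net of [x] is a net for [z] that [T] fixes. *)
Lemma extends_idem x z : extends x z -> extends z z.
Proof.
move=> hz; have [x0 [z1 z2]] := hz; apply/TD_extends.
have z_lub : is_lub (range (iota \o (T \o (sval : {a : E | below x a} -> E)))) z.
  split=> [_ [[a ax] _ <-]|w hw]; first by apply: z1; exists a.
  by apply: z2 => _ [a ax <-]; apply: hw; exists (exist _ a ax).
exists {a : E | below x a}, (@below_le x), (T \o sval); split.
  split=> //; first exact: below_directed.
  - by move=> a b ab; apply: (T_le ab).
  - by case=> a [a0 ax]; apply: T_ge0.
  split.
    by exists 0 => _ [[a [a0 ax]] _ <-] /=; rewrite iota_ge0 !T_ge0.
  exists z => _ [[a ax] _ <-] /=; rewrite T_idem.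
  by apply: z1; exists a.
by split=> [_ [[a ax] _ <-]|w hw] /=; rewrite ?T_idem;
  [apply: z1; exists a | case: z_lub => _; apply => _ [a _ <-] /=;
   rewrite -T_idem; apply: hw; exists a].
Qed.

(** Monotone convergence: an element of [E] below [s] is the supremum of its
    truncations by the [x n], which lie in [E] because [E] is an ideal. *)
Lemma dominated_lub (x : nat -> Eu) s W : (forall n, 0 <= x n) ->
  (forall m n, (m <= n)%N -> x m <= x n) -> is_lub (range x) s ->
  (forall n, dominated (x n) W) -> dominated s W.
Proof.
move=> x0 xle xs xW; have [s1 _] := xs.
split; first by apply: le_trans (x0 0%N) (s1 _ _); exists 0%N.
move=> a [a0 as_]; have a0' : 0 <= iota a by rewrite iota_ge0.
have /choice [b hb] : forall n, exists b, iota b = rmeet (iota a) (x n).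
  by move=> n; apply: (iota_ideal (rmeet_ge0 a0' (x0 n))); apply: rmeetl.
have b_lub : is_lub (range b) a.
  have [h1 h2] := lub_meet as_ xs; split => [_ [n _ <-]|c hc].
    by rewrite -iota_le hb rmeetl.
  rewrite -iota_le; apply: h2 => _ [n _ <-]; rewrite -hb iota_le.
  by apply: hc; exists n.
have dn : directed (fun m n : nat => (m <= n)%N).
  split=> //; [exact: (inhabits 0%N) | by move=> i j k; apply: leq_trans |] => i j.
  by exists (maxn i j); split; rewrite ?leq_maxl ?leq_maxr.
have ble m n : (m <= n)%N -> b m <= b n.
  by move=> /xle h; rewrite -iota_le !hb rmeet_le2.
have [_] := iota_lub (T_lub dn ble b_lub); apply => _ [_ [n _ <-] <-] /=.
case: (xW n) => _; apply; split; rewrite ?hb ?rmeetr //.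
by rewrite -iota_ge0 hb rmeet_ge0.
Qed.

(** * The natural domain and the range *)

Local Notation L1 := (L1 iota T).
Local Notation Tu := (Text iota T).
Local Notation RT := (RT iota T).
Local Notation S := (spectral_comp u).

Lemma domD_extends x : domD iota T x <-> exists z, extends x z.
Proof.
split=> [/domD_dominated[W /dominated_extends] //|[z /extends_dominated xz]].
by apply/domD_dominated; exists z.
Qed.

Lemma L1P x : L1 x <-> exists (a b s t : Eu), [/\ extends a s, extends b t & x = a - b].
Proof.
split=> [[a [b [/domD_extends[s ha] /domD_extends[t hb] ->]]]|].
  by exists a, b, s, t.
move=> [a [b [s [t [ha hb ->]]]]]; exists a, b.
by split=> //; apply/domD_extends; [exists s | exists t].
Qed.

Lemma extends0 : extends 0 0.
Proof. by have := extends_iota (lexx 0); rewrite T0 iota0. Qed.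

Lemma Text_sub x y z w : extends x z -> extends y w -> Tu (x - y) = z - w.
Proof.
move=> hx hy; rewrite /Text; case: xgetP => [v _|/(_ (z - w))[]]; last first.
  by exists x, y, z, w; split => //; apply/TD_extends.
move=> [a [b [s [t [/TD_extends ha /TD_extends hb h ->]]]]].
have h1 : a + y = x + b.
  transitivity ((a - b) + (b + y)); first by linear R.
  by rewrite -h; linear R.
have := extendsD ha hy; rewrite h1 => /(extends_unique (extendsD hx hb)) h2.
transitivity ((s + w) - t - w); first by linear R.
by rewrite -h2; linear R.
Qed.

Lemma Text_extends x z : extends x z -> Tu x = z.
Proof. by move=> /Text_sub /(_ extends0); rewrite !subr0. Qed.

Lemma extends_L1 x z : extends x z -> L1 x.
Proof.
by move=> hx; apply/L1P; exists x, 0, z, 0; split => //; [exact: extends0 | rewrite subr0].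
Qed.

Lemma dominated_L1 x W : dominated x W -> L1 x /\ Tu x <= W.
Proof.
move=> xW; have [z hz] := dominated_extends xW.
by split; [exact: extends_L1 hz | rewrite (Text_extends hz); exact: extends_le hz xW].
Qed.

Lemma extends_Text x : 0 <= x -> L1 x -> extends x (Tu x).
Proof.
move=> x0 /L1P[a [b [s [t [ha hb h]]]]].
have [b0 _] := hb.
have [z hz] : exists z, extends x z.
  apply: (@dominated_extends x s); apply: dominated_le (extends_dominated ha) => //.
  by rewrite h; apply: (rle_of b0); linear R.
by rewrite (Text_extends hz).
Qed.

Lemma Text_dominated x W : 0 <= x -> L1 x -> Tu x <= W -> dominated x W.
Proof.
move=> x0 Lx h; apply: dominated_le (lexx _) h (extends_dominated _) => //.
exact: extends_Text.
Qed.

Lemma L1_TextD x y : L1 x -> L1 y -> L1 (x + y) /\ Tu (x + y) = Tu x + Tu y.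
Proof.
move=> /L1P[a [b [s [t [ha hb ->]]]]] /L1P[a' [b' [s' [t' [ha' hb' ->]]]]].
have h := extendsD ha ha'; have h' := extendsD hb hb'.
have -> : a - b + (a' - b') = a + a' - (b + b') by linear R.
rewrite (Text_sub h h') (Text_sub ha hb) (Text_sub ha' hb'); split; last by linear R.
by apply/L1P; exists (a + a'), (b + b'), (s + s'), (t + t').
Qed.

Lemma L1_TextN x : L1 x -> L1 (- x) /\ Tu (- x) = - Tu x.
Proof.
move=> /L1P[a [b [s [t [ha hb ->]]]]].
rewrite opprB (Text_sub ha hb) (Text_sub hb ha) opprB; split => //.
by apply/L1P; exists b, a, t, s.
Qed.

Lemma L1_TextZ (k : R) x : 0 <= k -> L1 x -> L1 (k *: x) /\ Tu (k *: x) = k *: Tu x.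
Proof.
move=> k0 /L1P[a [b [s [t [ha hb ->]]]]].
have h := extendsZ k0 ha; have h' := extendsZ k0 hb.
rewrite scalerBr (Text_sub h h') (Text_sub ha hb) scalerBr; split => //.
by apply/L1P; exists (k *: a), (k *: b), (k *: s), (k *: t).
Qed.

Lemma L1D x y : L1 x -> L1 y -> L1 (x + y).
Proof. by move=> hx hy; case: (L1_TextD hx hy). Qed.

Lemma L1N x : L1 x -> L1 (- x).
Proof. by move=> /L1_TextN[]. Qed.

Lemma L1B x y : L1 x -> L1 y -> L1 (x - y).
Proof. by move=> hx /L1N; apply: L1D. Qed.

Lemma L1Z (k : R) x : 0 <= k -> L1 x -> L1 (k *: x).
Proof. by move=> k0 /(L1_TextZ k0)[]. Qed.

Lemma TextB x y : L1 x -> L1 y -> Tu (x - y) = Tu x - Tu y.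
Proof.
move=> hx hy; have [h1 h2] := L1_TextN hy.
by have [_ ->] := L1_TextD hx h1; rewrite h2.
Qed.

Lemma Text_ge0 x : 0 <= x -> L1 x -> 0 <= Tu x.
Proof. by move=> x0 hx; apply: (extends_ge0 (extends_Text x0 hx)). Qed.

Lemma Text_le x y : L1 x -> L1 y -> x <= y -> Tu x <= Tu y.
Proof.
move=> hx hy; rewrite -rsub_ge0 => /Text_ge0 /(_ (L1B hy hx)).
by rewrite (TextB hy hx) rsub_ge0.
Qed.

Lemma L1_below x y : 0 <= x -> x <= y -> L1 y -> L1 x.
Proof.
move=> x0 xy hy; have h := extends_Text (le_trans x0 xy) hy.
by case: (dominated_L1 (dominated_le x0 xy (lexx _) (extends_dominated h))).
Qed.

Lemma L1_solid x y : rabs x <= y -> L1 y -> L1 x.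
Proof.
move=> xy hy; rewrite -(rpos_subN x); apply: L1B.
  by apply: (L1_below _ _ hy); rewrite ?rpos_ge0 // (le_trans (rpos_le_abs _)).
by apply: (L1_below _ _ hy); rewrite ?rpos_ge0 // (le_trans (rpos_le_abs _)) // rabsN.
Qed.

Lemma L1_abs x : L1 x -> L1 (rabs x).
Proof.
move=> /L1P[a [b [s [t [ha hb ->]]]]].
have [a0 _] := ha; have [b0 _] := hb.
apply: (@L1_below _ (a + b)); first exact: rabs_ge0.
  by have := rabsD a (- b); rewrite rabsN (rabs_id a0) (rabs_id b0).
by apply: L1D; apply: extends_L1; eassumption.
Qed.

(** A nonzero [x] has an element [a > 0] of [E] below it, and [T a > 0]. *)
Lemma Text_eq0 x : 0 <= x -> L1 x -> Tu x = 0 -> x = 0.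
Proof.
move=> x0 hx h; apply: contrapT => n0; have [a a0 ax] := iota_dense (rgt0 x0 n0).
have [_ [z1 _]] := extends_Text x0 hx.
have Ta : 0 < T a by case: hT => _ _ [_ Tp _ _ _]; apply: Tp.
have : iota (T a) <= 0 by rewrite -h; apply: z1; exists a => //; split => //; apply: ltW.
by rewrite -iota0 iota_le lt_geF.
Qed.

Lemma Text_idem x : L1 x -> L1 (Tu x) /\ Tu (Tu x) = Tu x.
Proof.
move=> /L1P[a [b [s [t [ha hb ->]]]]].
have h := extends_idem ha; have h' := extends_idem hb.
rewrite (Text_sub ha hb) (Text_sub h h'); split => //.
by apply: L1B; apply: extends_L1; eassumption.
Qed.

Lemma RTP x : RT x <-> L1 x /\ Tu x = x.
Proof.
split=> [[y hy <-]|[hx h]]; first exact: Text_idem.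
by exists x.
Qed.

Lemma RT_L1 x : RT x -> L1 x. Proof. by case/RTP. Qed.

Lemma RT_Text x : L1 x -> RT (Tu x). Proof. by move=> hx; exists x. Qed.

Lemma RTD x y : RT x -> RT y -> RT (x + y).
Proof.
move=> /RTP[hx ex] /RTP[hy ey]; apply/RTP.
by have [h ->] := L1_TextD hx hy; rewrite ex ey.
Qed.

Lemma RTN x : RT x -> RT (- x).
Proof. by move=> /RTP[/L1_TextN[hx ex] e']; apply/RTP; rewrite ex e'. Qed.

Lemma RTB x y : RT x -> RT y -> RT (x - y).
Proof. by move=> hx /RTN; apply: RTD. Qed.

Lemma RTZ (k : R) x : 0 <= k -> RT x -> RT (k *: x).
Proof. by move=> k0 /RTP[/(L1_TextZ k0)[hx ex] e']; apply/RTP; rewrite ex e'. Qed.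

Lemma RT_unit : RT u.
Proof.
have Te : T e = e by case: hT => _ _ [].
have h := extends_iota unit_ge0; rewrite Te in h.
by apply/RTP; split; [exact: extends_L1 h | exact: Text_extends].
Qed.

(** The image of [s] dominates [s], because it dominates every element of [A]; the
    difference is mapped to 0, so it vanishes by strict positivity. *)
Lemma RT_lub (A : set Eu) s (b : Eu) : A !=set0 -> A `<=` RT -> is_lub A s -> L1 b ->
  (forall x, A x -> x <= b) -> RT s.
Proof.
move=> [a0 Aa0] AR [s1 s2] hb Ab; have ha0 := RT_L1 (AR _ Aa0).
have hs : L1 s.
  have -> : s = a0 + (s - a0) by linear R.
  apply: (L1D ha0); apply: (@L1_below _ (b - a0)).
  - by rewrite rsub_ge0 s1.
  - by apply: riesz_leD2r; apply: s2.
  - exact: L1B.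
have sT : s <= Tu s.
  apply: s2 => a Aa; have /RTP[ha <-] := AR _ Aa.
  by apply: Text_le => //; apply: s1.
have [hTs TT] := Text_idem hs.
apply/RTP; split=> //; have := @Text_eq0 (Tu s - s).
rewrite rsub_ge0 sT (TextB hTs hs) TT subrr => /(_ isT (L1B hTs hs) erefl) h.
by transitivity (Tu s - s + s); [linear R | rewrite h; linear R].
Qed.

Lemma RT_join x y : RT x -> RT y -> RT (rjoin x y).
Proof.
move=> hx hy; apply: (@RT_lub [set z | z = x \/ z = y] _ (rabs x + rabs y)).
- by exists x; left.
- by move=> z [->|->].
- split => [z [->|->]|z hz]; [exact: rjoinl | exact: rjoinr |].
  by apply: rjoin_lub; apply: hz; [left | right].
- by apply: L1D; apply: L1_abs; apply: RT_L1.
move=> z [->|->].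
  by apply: (rle_of (rle_add (rabs_ge x) (rabs_ge0 y))); linear R.
by apply: (rle_of (rle_add (rabs_ge y) (rabs_ge0 x))); linear R.
Qed.

Lemma RT_meet x y : RT x -> RT y -> RT (rmeet x y).
Proof.
move=> hx hy; have -> : rmeet x y = x + y - rjoin x y.
  by rewrite -(radd_join_meet x y); linear R.
by apply: RTB; [exact: RTD | exact: RT_join].
Qed.

Lemma RT0 : RT 0.
Proof. by have := RTB RT_unit RT_unit; rewrite subrr. Qed.

Lemma RT_spectral x t : RT x -> RT (S x t).
Proof.
move=> hx; have hu := RT_unit.
have ht : RT (x - t *: u).
  have [t0|t0] := leP 0 t; first by apply: RTB => //; apply: RTZ.
  rewrite -scaleNr; apply: RTD => //; apply: RTZ => //.
  by rewrite oppr_ge0 ltW.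
apply: (RT_lub _ _ (spectral_lub dc u x t) (RT_L1 hu)).
- by exists (rmeet (0%:R *: rpos (x - t *: u)) u), 0%N.
- move=> _ [k _ <-]; apply: RT_meet => //; apply: RTZ => //.
  by apply: RT_join => //; apply: RT0.
by move=> _ [k _ <-]; apply: rmeetr.
Qed.

(** * Locality *)

(** The indicators of the sets that are measurable for the range. *)
Definition event c := component u c /\ RT c.

Lemma event_ge0 c : event c -> 0 <= c. Proof. by case=> [[]]. Qed.

Lemma event_meet c d : event c -> event d -> event (rmeet c d).
Proof.
move=> [[c0 cu cc] hc] [[d0 du dd] hd]; split; last exact: RT_meet.
have m0 := rmeet_ge0 c0 d0.
split=> //; first exact: le_trans (rmeetl _ _) cu.
have uc : 0 <= u - c by rewrite rsub_ge0.
have ud : 0 <= u - d by rewrite rsub_ge0.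
have h : rmeet ((u - c) + (u - d)) (rmeet c d) = 0.
  apply: meet0D => //; rewrite rmeetC.
    exact: (meet0_le m0 uc (rmeetl _ _) (lexx _) cc).
  exact: (meet0_le m0 ud (rmeetr _ _) (lexx _) dd).
rewrite rmeetC; apply: (meet0_le _ m0 _ (lexx _) h).
  by rewrite rsub_ge0 (le_trans (rmeetl _ _) cu).
have e1 : rjoin c d <= u by apply: rjoin_lub.
have e2 : rmeet c d = c + d - rjoin c d.
  by rewrite -(radd_join_meet c d); linear R.
by rewrite e2; apply: (rle_of e1); linear R.
Qed.

Lemma event_diff c d : event c -> event d -> d <= c -> event (c - d).
Proof.
move=> [[c0 cu cc] hc] [[d0 du dd] hd] dc'; split; last exact: RTB.
have cd0 : 0 <= c - d by rewrite rsub_ge0.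
have uc : 0 <= u - c by rewrite rsub_ge0.
have ud : 0 <= u - d by rewrite rsub_ge0.
have cdc : c - d <= c by apply: (rle_of d0); linear R.
split=> //; first exact: le_trans cu.
have -> : u - (c - d) = (u - c) + d by linear R.
rewrite rmeetC; apply: meet0D => //; rewrite rmeetC.
  exact: (meet0_le cd0 uc cdc (lexx _) cc).
rewrite rmeetC; apply: (meet0_le d0 cd0 (lexx _) _ dd).
exact: riesz_leD2r.
Qed.

Lemma event_unit : event u.
Proof.
split; last exact: RT_unit.
by split=> //; rewrite subrr rmeetC rmeet_eql.
Qed.

(** The truncations of [z] are dominated by multiples of the complementary event,
    which the operator fixes. *)
Lemma Text_disjoint c z : event c -> 0 <= z -> L1 z -> rmeet z c = 0 ->
  rmeet (Tu z) c = 0.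
Proof.
move=> [[c0 cu cc] hc] z0 hz zc; have uc : 0 <= u - c by rewrite rsub_ge0.
have Tz0 := Text_ge0 z0 hz.
pose A := range (fun k : nat => rmeet (k%:R *: (u - c)) (Tu z)).
have [||w hw] := @lub_exists _ _ A (Tu z) dc.
- by exists (rmeet (0%:R *: (u - c)) (Tu z)), 0%N.
- by move=> _ [k _ <-]; apply: rmeetr.
have [w1 w2] := hw.
have w0 : 0 <= w.
  have : rmeet (0%:R *: (u - c)) (Tu z) <= w by apply: w1; exists 0%N.
  by apply: le_trans; rewrite scale0r rmeet_ge0.
have wc : rmeet w c = 0.
  apply: (meet0_lub w0 c0 hw) => _ [k _ <-].
  apply: (meet0_le _ c0 (rmeetl _ _) (lexx c)); first by rewrite rmeet_ge0 ?rscale_ge0.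
  by apply: meet0Z => //; rewrite rmeetC.
suff zw : dominated z w.
  by apply: (meet0_le Tz0 c0 _ (lexx c) wc); case: (dominated_L1 zw).
have zk0 n : 0 <= rmeet z (n%:R *: u) by rewrite rmeet_ge0 ?rscale_ge0.
apply: (dominated_lub zk0 _ (unit_lub dc wu z0)).
  by move=> m n mn; apply: rmeet_le2 => //; apply: rscale_lel; rewrite ?ler_nat.
move=> n; have hzn : L1 (rmeet z (n%:R *: u)) by apply: L1_below (rmeetl _ _) hz.
apply: Text_dominated => //.
apply: le_trans (w1 _ _); last by exists n.
apply: rmeet_glb; last by apply: Text_le => //; apply: rmeetl.
have /RTP[hk <-] : RT (n%:R *: (u - c)) by apply: RTZ => //; apply: RTB => //; apply: RT_unit.
apply: Text_le => //.
have -> : n%:R *: u = n%:R *: c + n%:R *: (u - c) by linear R.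
rewrite rmeetC; apply: le_trans (rmeetDl_le _ _ z0) _; rewrite ?rscale_ge0 //.
have -> : rmeet (n%:R *: c) z = 0 by apply: meet0Z => //; rewrite rmeetC.
by rewrite add0r rmeetl.
Qed.

(** The part of [x] beyond [y] vanishes on [c], so its image does; hence on each event
    the image of [x] may be compared with that of the element [y] that
    dominates [x] there. *)
Lemma dominated_locally x W : 0 <= x ->
  (forall d, 0 < d -> exists c d' y, [/\ event c, 0 < d' /\ d' <= d, d' <= c,
      le_on c x y & [/\ 0 <= y, L1 y & le_on c (Tu y) W]]) ->
  dominated x W.
Proof.
move=> x0 h; split=> // a [a0 ax]; apply: le_dense => d d0.
have [c [d' [y [ec [d'0 d'd] d'c xy [y0 hy yW]]]]] := h _ d0.
exists d'; split => //; have c0 := event_ge0 ec; apply: (le_on_sub (ltW d'0) d'c).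
have ha := extends_iota a0.
set z := rpos (iota a - y).
have z0 : 0 <= z := rpos_ge0 _.
have hz : L1 z.
  apply: (L1_below z0 _ (extends_L1 ha)); apply: rpos_lub; first by rewrite iota_ge0.
  by apply: (rle_of y0); linear R.
have zc : rmeet z c = 0 := le_on_trans c0 (le_onW c0 ax) xy.
have Tzc := Text_disjoint ec z0 hz zc.
have [hyz Tyz] := L1_TextD hy hz.
have h1 : iota (T a) <= Tu y + Tu z.
  rewrite -Tyz -(Text_extends ha); apply: Text_le (extends_L1 ha) hyz _.
  exact: le_on_exc.
apply: (le_on_trans c0 _ yW).
exact: (le_onI c0 (Text_ge0 z0 hz) Tzc h1).
Qed.

(** * Increasing sequences with bounded images *)

Lemma spectral_mul_le y t : 0 <= y -> 0 <= t -> t *: S y t <= y.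
Proof.
move=> y0 t0; have S0 := spectral_ge0 dc wu y t.
apply: (le_on_le (k := t) S0 t0 y0) => //.
apply: (le_on_trans S0 _ (spectral_gt dc wu y t)); apply: le_onW => //.
by apply: rscale_le => //; apply: spectral_le_unit.
Qed.

(** On an event where the sequence exceeds every [n], the image of each [n a] with [a]
    below that event is at most [W], which contradicts strict positivity.  So the
    components [H n] where some [q k > n] vanish, and the bounds [n u] that hold
    outside them glue. *)
Lemma dominated_bounded (q : nat -> Eu) W : (forall k, 0 <= q k) ->
  (forall j k, (j <= k)%N -> q j <= q k) -> (forall k, dominated (q k) W) ->
  exists w, forall k, q k <= w.
Proof.
move=> q0 qle qW.
pose A n := range (fun k => S (q k) n%:R).
have A0 n : A n !=set0 by exists (S (q 0%N) n%:R), 0%N.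
pose H n := supremum 0 (A n).
have Hlub n : is_lub (A n) (H n).
  by apply: (supremumP (b := u)) => // _ [k _ <-]; apply: spectral_le_unit.
have Hc n : component u (H n).
  by apply: (component_lub (A0 n) _ (Hlub n)) => _ [k _ <-]; apply: spectral_component.
have SH k n : S (q k) n%:R <= H n by case: (Hlub n) => h _; apply: h; exists k.
have HH : vanishing u H.
  split=> // [n|c c0].
    case: (Hlub n.+1) => _; apply=> _ [k _ <-]; apply: le_trans (SH k n).
    by apply: spectral_homo => //; rewrite ler_nat.
  apply: contrapT => nH.
  have cH n : rmeet (u - H n) c = 0.
    have [H0 Hu HuH] := Hc n; have uH := component_co (Hc n).
    apply: contrapT => n0; apply: nH; exists n, (rmeet (u - H n) c); split.
    - by apply: rgt0 n0; rewrite rmeet_ge0 // ltW.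
    - exact: rmeetr.
    - apply: (meet0_le H0 _ (lexx _) (rmeetl _ _) HuH).
      by rewrite rmeet_ge0 // ltW.
  have c1_le n : rmeet u c <= H n.
    apply: (le_on_le (k := 1) (ltW c0)) => //; first by case: (Hc n).
      by rewrite scale1r rmeetr.
    apply: (le_on_trans (ltW c0) (le_onW (ltW c0) (rmeetl u c))).
    exact: unit_le_on (Hc n) (ltW c0) (cH n).
  have [a a0 ac] := iota_dense (rgt0 (rmeet_ge0 u0 (ltW c0)) (unit_meet_neq0 wu c0)).
  have Ta0 : 0 < T a by case: hT => _ _ [_ Tp _ _ _]; apply: Tp.
  have : iota (T a) <= 0.
    apply: (archimedean (b := W) dc) => n; rewrite -iotaZ -TZ.
    have : dominated (n%:R *: H n) W.
      have hl := lub_scale (ler0n R n) (A0 n) (Hlub n).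
      have hl' : is_lub (range (fun k => n%:R *: S (q k) n%:R)) (n%:R *: H n).
        case: hl => h1 h2; split => [_ [k _ <-]|z hz].
          by apply: h1; exists (S (q k) n%:R) => //; exists k.
        by apply: h2 => _ [_ [k _ <-] <-]; apply: hz; exists k.
      apply: (dominated_lub _ _ hl') => [k|j k /qle jk|k].
      - by rewrite rscale_ge0 // spectral_ge0.
      - by apply: rscale_le => //; apply: spectral_homo.
      apply: dominated_le (lexx W) (qW k); last exact: spectral_mul_le.
      by rewrite rscale_ge0 // spectral_ge0.
    case=> _; apply; split; first by rewrite rscale_ge0 // ltW.
    by rewrite iotaZ; apply: rscale_le => //; apply: le_trans ac (c1_le n).
  by rewrite -iota0 iota_le lt_geF.
have [b hb] := glue dc HH (fun n => n%:R *: u) lc.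
exists b => k; apply: le_dense => c c0.
have [n [c' [c'0 c'c c'p]]] := piece_dense wu HH c0.
exists c'; split => //; apply: (le_on_sub (ltW c'0) c'p).
have p0 := piece_ge0 HH n.
have [_ h] := hb n; apply: (le_on_trans p0 _ h).
apply: (le_on_sub p0 _ (spectral_le dc u (q k) n%:R)).
apply: le_trans (piece_co HH n) _.
by have h1 := SH k n; apply: (rle_of h1); linear R.
Qed.

(** * Finite exponents *)

Lemma dominatedD x y w W : dominated x w -> dominated y W ->
  dominated (x + y) (w + W).
Proof.
move=> xw yW; have [s hs] := dominated_extends xw; have [t ht] := dominated_extends yW.
have h := extends_dominated (extendsD hs ht).
apply: dominated_le h => //; first by case: xw yW => x0 _ [y0 _]; apply: radd_ge0.
by apply: rle_add; [exact: extends_le hs xw | exact: extends_le ht yW].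
Qed.

Lemma dominatedZ (k : R) x W : 0 <= k -> dominated x W -> dominated (k *: x) (k *: W).
Proof.
move=> k0 xW; have [s hs] := dominated_extends xW.
have h := extends_dominated (extendsZ k0 hs).
apply: dominated_le h => //; first by case: xW => x0 _; apply: rscale_ge0.
by apply: rscale_le => //; apply: extends_le hs xW.
Qed.

Lemma dominated_unit : dominated u u.
Proof.
by case/RTP: RT_unit => hu eu; apply: Text_dominated; rewrite ?eu.
Qed.

Section Finite_exponent.
Variables (p : R) (p1 : 1 <= p).

Let p0 : 0 < p. Proof. exact: lt_le_trans p1. Qed.

Local Notation pw := (rpow u p).

Let pw_ge0 x : 0 <= pw x. Proof. exact: rpow_ge0. Qed.

(** By convexity [(x + y) ^ p] is at most a multiple of [x ^ p + y ^ p]. *)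
Lemma L1_pow_triangle x y z : L1 (pw (rabs x)) -> L1 (pw (rabs y)) ->
  rabs z <= rabs x + rabs y -> L1 (pw (rabs z)).
Proof.
move=> hx hy hz; apply: (L1_below (pw_ge0 _) _ (L1Z (powR_ge0 2^-1 (1 - p)) (L1D hx hy))).
apply: le_trans (rpowD_le dc lc wu p1 (rabs_ge0 _) (rabs_ge0 _)).
by apply: rpow_homo => //; apply: rabs_ge0.
Qed.

Lemma L1_of_pow x : L1 (pw (rabs x)) -> L1 x.
Proof.
move=> hx; apply: (@L1_solid _ (pw (rabs x) + u)).
  exact: le_rpow_unit (rabs_ge0 _).
by apply: L1D => //; apply: RT_L1; apply: RT_unit.
Qed.

Lemma le_on_abs_sub c x y x' y' : 0 <= c ->
  le_on c x y /\ le_on c y x -> le_on c x' y' /\ le_on c y' x' ->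
  le_on c (rabs (x - x')) (rabs (y - y')).
Proof.
move=> c0 [h1 h2] [h3 h4]; apply: le_on_abs => //.
  by apply: (le_on_trans c0 (le_onD c0 h1 (le_onN h4))); apply: le_onW (rabs_ge _).
apply: (le_on_trans c0 (y := - (y - y'))); last exact: le_onW (rabs_geN _).
by apply: le_onN; apply: le_onD => //; apply: le_onN.
Qed.

Section Limit.
Variable f : nat -> Eu.
Hypothesis fL : forall n, L1 (pw (rabs (f n))).

Let X m n := Tu (pw (rabs (f m - f n))).

(** The Cauchy condition in measure: the components where some late [X m n] exceeds
    [t] decrease to 0. *)
Hypothesis X_small : forall t c, 0 < t -> 0 < c -> exists N c',
  [/\ 0 < c', c' <= c &
      forall m n, (N <= m)%N -> (N <= n)%N -> rmeet (S (X m n) t) c' = 0].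

Let fd_L1 m n : L1 (pw (rabs (f m - f n))).
Proof.
apply: (L1_pow_triangle (fL m) (fL n)).
by apply: le_trans (rabsD _ _) _; rewrite rabsN.
Qed.

Let X_RT m n : RT (X m n). Proof. exact: RT_Text. Qed.

(** The event that some [X m n] with both indices at least [N] exceeds [t]. *)
Let tail t N := [set z | exists m n, [/\ (N <= m)%N, (N <= n)%N & z = S (X m n) t]].
Let bad t N := supremum 0 (tail t N).

Let tail0 t N : tail t N !=set0.
Proof. by exists (S (X N N) t), N, N. Qed.

Let bad_lub t N : is_lub (tail t N) (bad t N).
Proof.
by apply: (supremumP (b := u)) => // _ [m [n [_ _ ->]]]; apply: spectral_le_unit.
Qed.

Let bad_ge t N m n : (N <= m)%N -> (N <= n)%N -> S (X m n) t <= bad t N.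
Proof. by move=> Nm Nn; case: (bad_lub t N) => h _; apply: h; exists m, n. Qed.

Let bad_event t N : event (bad t N).
Proof.
split.
  apply: (component_lub (tail0 t N) _ (bad_lub t N)) => _ [m [n [_ _ ->]]].
  exact: spectral_component.
apply: (RT_lub (tail0 t N) _ (bad_lub t N) (RT_L1 RT_unit)).
  by move=> _ [m [n [_ _ ->]]]; apply: RT_spectral.
by move=> _ [m [n [_ _ ->]]]; apply: spectral_le_unit.
Qed.

Let weight k : R := 2^-1 ^+ k.+1.
(* chosen so that [weight k ^ (1 - p) * level k = weight k] *)
Let level k : R := weight k `^ p.

Let weight_gt0 k : 0 < weight k.
Proof. by rewrite exprn_gt0 // invr_gt0. Qed.

Let level_gt0 k : 0 < level k. Proof. exact: powR_gt0. Qed.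

Let level_anti k : level k.+1 <= level k.
Proof.
apply: powR_le; [exact: ltW | exact: ltW |].
by rewrite /weight exprS ger_pMl ?exprn_gt0 ?invr_gt0 // invf_le1 ?ler1n.
Qed.

Let sum_weight K : \sum_(k < K) weight k <= 1.
Proof.
suff -> : \sum_(k < K) weight k = 1 - 2^-1 ^+ K by rewrite gerBl exprn_ge0 // invr_ge0.
elim: K => [|K IHK]; first by rewrite big_ord0 expr0 subrr.
by rewrite big_ord_recr /= IHK /weight exprS; field.
Qed.

(** The stopping time of stage [k] takes values at least [k], and is [n + k] on
    piece [n] of [stop k]. *)
Let stop k n := bad (level k) (n + k).

Let stop_vanishing k : vanishing u (stop k).
Proof.
split=> [n|n|c c0]; first by case: (bad_event (level k) (n + k)).
  case: (bad_lub (level k) (n.+1 + k)) => _; apply => _ [m [l [nm nl ->]]].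
  by apply: bad_ge; [apply: leq_trans nm | apply: leq_trans nl]; rewrite leq_add2r.
have [N [c' [c'0 c'c h]]] := X_small (level_gt0 k) c0.
exists N, c'; split => //; have [[b0 _ _] _] := bad_event (level k) (N + k).
apply: (meet0_lub b0 (ltW c'0) (bad_lub _ _)) => _ [m [l [Nm Nl ->]]].
by apply: h; [apply: leq_trans Nm | apply: leq_trans Nl]; apply: leq_addr.
Qed.

Let stage k n := piece u (stop k) n.

Let stage_ge0 k n : 0 <= stage k n.
Proof. exact: piece_ge0 (stop_vanishing k) n. Qed.

Let stage_event k n : event (stage k n).
Proof.
have h := vanishing_le (stop_vanishing k).
case: n => [|n]; apply: event_diff; rewrite /stop; try exact: bad_event.
- exact: event_unit.
- by case: (bad_event (level k) (0 + k)) => [[]].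
- exact: h.
Qed.

Let stage_small k n m l : (n + k <= m)%N -> (n + k <= l)%N ->
  le_on (stage k n) (X m l) (level k *: u).
Proof.
move=> nm nl; apply: (le_on_sub (stage_ge0 k n) _ (spectral_le dc u _ _)).
apply: le_trans (piece_co (stop_vanishing k) n) _.
by apply: (rle_of (bad_ge (level k) nm nl)); rewrite /stop; linear R.
Qed.

(** The increments of the glued sequence [G] have summable images, so [G] converges
    to some [g] with [|g - G k| <= Q - q k].  The truncations
    [z k = (|f n - g| - (Q - q k))^+] increase to [|f n - g|] and lie below [|f n - G k|],
    whose power is controlled by [W] for [k >= N]. *)
Lemma limit_exists : exists g, forall n N W,
  (forall m, (N <= m)%N -> X n m <= W) -> dominated (pw (rabs (f n - g))) W.
Proof.
have /choice [G hG] : forall k, exists g, forall n,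
    le_on (stage k n) g (f (n + k)%N) /\ le_on (stage k n) (f (n + k)%N) g.
  by move=> k; apply: (glue dc (stop_vanishing k) (fun n => f (n + k)%N) lc).
have eq_on_sub c c' x y : 0 <= c' -> c' <= c ->
    le_on c x y /\ le_on c y x -> le_on c' x y /\ le_on c' y x.
  by move=> c0 cc [h h']; split; [exact: le_on_sub h | exact: le_on_sub h'].
have eq_on_refl c x : 0 <= c -> le_on c x x /\ le_on c x x.
  by move=> c0; split; apply: le_onW.
pose d k := rabs (G k.+1 - G k).
have d0 k : 0 <= d k by apply: rabs_ge0.
have dT k : dominated (pw (d k)) (level k *: u).
  apply: dominated_locally => // b b0.
  have [n [b1 [b10 b1b b1n]]] := piece_dense wu (stop_vanishing k) b0.
  have [m [b2 [b20 b2b1 b2m]]] := piece_dense wu (stop_vanishing k.+1) b10.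
  pose c := rmeet (stage k n) (stage k.+1 m).
  have c0 : 0 <= c := rmeet_ge0 (stage_ge0 k n) (stage_ge0 k.+1 m).
  exists c, b2, (pw (rabs (f (m + k.+1)%N - f (n + k)%N))); split.
  - exact: event_meet.
  - by split => //; apply: le_trans b2b1 b1b.
  - exact: (rmeet_glb (le_trans b2b1 b1n) b2m).
  - apply: rpow_homo_on; rewrite ?rabs_ge0 //; apply: le_on_abs_sub => //.
      exact: eq_on_sub c0 (rmeetr _ _) (hG k.+1 m).
    exact: eq_on_sub c0 (rmeetl _ _) (hG k n).
  split => //; have [nm|mn] := leqP (n + k) (m + k.+1).
    by apply: (le_on_sub c0 (rmeetl _ _)); apply: stage_small.
  apply: (le_on_trans c0 (y := level k.+1 *: u)).
    by apply: (le_on_sub c0 (rmeetr _ _)); apply: stage_small => //; apply: ltnW.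
  by apply: (le_onW c0); apply: rscale_lel.
have GT n N W k : (forall m, (N <= m)%N -> X n m <= W) -> (N <= k)%N ->
    dominated (pw (rabs (f n - G k))) W.
  move=> hW Nk; apply: dominated_locally => // b b0.
  have [m [b1 [b10 b1b b1m]]] := piece_dense wu (stop_vanishing k) b0.
  exists (stage k m), b1, (pw (rabs (f n - f (m + k)%N))); split => //.
    apply: rpow_homo_on; rewrite ?rabs_ge0 //; apply: le_on_abs_sub => //.
    exact: eq_on_refl.
  split => //; apply: le_onW => //; apply: hW.
  exact: leq_trans Nk (leq_addl _ _).
pose q K := \sum_(k < K) d k.
have q0 K : 0 <= q K by apply: rsum_ge0.
have qS K : q K.+1 = q K + d K by rewrite /q big_ord_recr.
have q_le j k : (j <= k)%N -> q j <= q k.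
  move=> /subnK <-; elim: (k - j)%N => // i IHi.
  by rewrite addSn qS; apply: (rle_of (rle_add IHi (d0 (i + j)%N))); linear R.
have qT K : dominated (q K) (u + u).
  apply: (@dominated_le _ (pw (q K) + u) (u + u)) => //; first exact: le_rpow_unit.
  apply: dominatedD; last exact: dominated_unit.
  apply: dominated_le (pw_ge0 _) (rpow_sum_le dc lc wu p1 weight_gt0 (sum_weight K) d0)
    (_ : (\sum_(k < K) weight k) *: u <= u) _.
    by rewrite -[leRHS]scale1r rscale_lel.
  elim: K => [|K IHK].
    by rewrite !big_ord0 scale0r; apply: extends_dominated extends0.
  rewrite !big_ord_recr /= scalerDl; apply: dominatedD => //.
  have -> : weight K *: u = weight K `^ (1 - p) *: (level K *: u).
    by rewrite scalerA /level -powRD ?subrK ?powRr1 ?ltW // (gt_eqF (weight_gt0 K)) implybT.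
  by apply: dominatedZ => //; apply: powR_ge0.
have [Q0 hQ0] := dominated_bounded q0 q_le qT.
have [||Q [Q1 Q2]] := @lub_exists _ _ (range q) Q0 dc.
- by exists (q 0%N), 0%N.
- by move=> _ [k _ <-].
have qQ k : q k <= Q by apply: Q1; exists k.
have G_near k i : rabs (G (i + k)%N - G k) <= q (i + k)%N - q k.
  elim: i => [|i IHi].
    rewrite !add0n !subrr rabs_id //.
  rewrite addSn qS; have h := rle_add IHi (lexx (d (i + k)%N)).
  apply: le_trans (_ : _ <= rabs (G (i + k)%N - G k) + d (i + k)%N) _.
    apply: le_trans (rabsD _ _); rewrite le_eqVlt; apply/orP; left; apply/eqP.
    by congr rabs; linear R.
  by apply: (rle_of h); linear R.
have Gq j k : G j + q j <= G k + q k + 2 *: (Q - q k).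
  have h := qQ k; have h' := qQ j.
  have [jk|/ltnW kj] := leqP j k.
    have := le_trans (rabs_geN _) (G_near j (k - j)%N); rewrite subnK // => h1.
    by apply: (rle_of (rle_add h1 (rle_add h h))); linear R.
  have := le_trans (rabs_ge _) (G_near k (j - k)%N); rewrite subnK // => h1.
  by apply: (rle_of (rle_add h1 (rle_add h' h'))); linear R.
have [||l [l1 l2]] := @lub_exists _ _ (range (fun k => G k + q k))
    (G 0%N + q 0%N + 2 *: (Q - q 0%N)) dc.
- by exists (G 0%N + q 0%N), 0%N.
- by move=> _ [k _ <-].
have gG k : rabs (l - Q - G k) <= Q - q k.
  have h1 : G k + q k <= l by apply: l1; exists k.
  have h2 : l <= G k + q k + 2 *: (Q - q k) by apply: l2 => _ [j _ <-].
  by apply: rabs_lub; [apply: (rle_of h2) | apply: (rle_of h1)]; linear R.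
exists (l - Q) => n N W hW; set g := l - Q in gG *.
(* monotone convergence along these truncations replaces Fatou's lemma *)
pose z k := rpos (rabs (f n - g) - (Q - q k)).
have z0 k : 0 <= z k := rpos_ge0 _.
have z_le j k : (j <= k)%N -> z j <= z k.
  by move=> /q_le h; apply: rpos_le; apply: (rle_of h); linear R.
have zG k : z k <= rabs (f n - G k).
  apply: rpos_lub; first exact: rabs_ge0.
  have h : rabs (f n - g) <= rabs (f n - G k) + rabs (g - G k).
    rewrite (rabs_distC g); have -> : f n - g = (f n - G k) + (G k - g) by linear R.
    exact: rabsD.
  by apply: (rle_of (rle_add h (gG k))); linear R.
have z_lub : is_lub (range z) (rabs (f n - g)).
  split=> [_ [k _ <-]|v hv].
    apply: rpos_lub; first exact: rabs_ge0.
    by apply: (rle_of (qQ k)); linear R.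
  have h : Q <= v + Q - rabs (f n - g).
    apply: Q2 => _ [k _ <-].
    have h : rabs (f n - g) - (Q - q k) <= v.
      by apply: le_trans (rpos_ge _) (hv _ _); exists k.
    by apply: (rle_of h); linear R.
  by apply: (rle_of h); linear R.
apply: (dominated_lub (x := fun k => pw (z k))) => [k|j k jk||k].
- exact: pw_ge0.
- by apply: rpow_homo => //; apply: z_le.
- split=> [_ [k _ <-]|v hv].
    by apply: rpow_homo => //; case: z_lub => h _; apply: h; exists k.
  apply: (rpow_lub_le dc lc wu p1 _ z_lub); first by exists (z 0%N), 0%N.
    by move=> _ [k _ <-].
  by move=> _ [k _ <-]; apply: hv; exists k.
apply: (dominated_le _ _ (lexx W) (GT n N W (k + N)%N hW (leq_addl _ _))) => //.
apply: rpow_homo => //; apply: le_trans (zG _); apply: z_le; exact: leq_addr.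
Qed.

End Limit.

(** The components where [T |f m - f n| ^ p > t] for late [m] and [n] vanish in the
    limit: otherwise [v j ^ p >= t] would hold for every [j] on one support [c], so
    that [t ^ (1 / p) c] would be below all [v j]. *)
Lemma complete_finite f : (forall n, Lp iota e T p%:E%E (f n)) ->
  strongly_cauchy iota e T p%:E%E f ->
  exists2 g, Lp iota e T p%:E%E g & strongly_cvg iota e T p%:E%E f g.
Proof.
move=> fL [J [leJ [v [dJ vdec hv]]]].
have [[j0] _ _ _] := dJ; have [vL _ [[_ v0] vinf]] := vdec.
have vj0 j : 0 <= v j by apply: v0; exists j.
have v_inf w : (forall j, w <= v j) -> w <= 0.
  move=> wv; have wv' j : rpos w <= v j by apply: rpos_lub.
  apply: le_trans (rpos_ge w) _; apply: vinf; split; last by move=> _ [j _ <-].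
  exact: L1_below (rpos_ge0 _) (wv' j0) (vL j0).
have fL' n : L1 (pw (rabs (f n))) by case: (fL n).
have fdL m n : L1 (pw (rabs (f m - f n))).
  apply: (L1_pow_triangle (fL' m) (fL' n)).
  by apply: le_trans (rabsD _ _) _; rewrite rabsN.
have Xv j : exists N, forall m n, (N <= m)%N -> (N <= n)%N ->
    Tu (pw (rabs (f m - f n))) <= pw (v j).
  have [[a b] hab] := hv j; exists (maxn a b) => m n am bn.
  have /= h := hab (m, n) (conj (leq_trans (leq_maxl _ _) am) (leq_trans (leq_maxr _ _) bn)).
  apply: (rpow_root_le dc lc wu p0) => //; first exact: Text_ge0.
  by rewrite subr0 in h; apply: le_trans (rabs_ge _) h.
have [||g hg] := @limit_exists f => //.
  move=> t c t0 c0; have c0' := ltW c0.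
  have [j hj] : exists j, ~ le_on c (t *: u) (pw (v j)).
    apply: contrapT => h.
    have tp : 0 < t `^ p^-1 by apply: powR_gt0.
    have : t `^ p^-1 *: rmeet u c <= 0.
      apply: v_inf => j; apply: (le_on_le (k := t `^ p^-1) c0') => //; first exact: ltW.
        by apply: rscale_le; [exact: ltW | exact: rmeetr].
      apply: (le_on_trans c0' (y := t `^ p^-1 *: u)).
        by apply: (le_onW c0'); apply: rscale_le; [exact: ltW | exact: rmeetl].
      apply: (rpow_ge_root dc lc wu p0 (ltW t0) c0') => //.
      by apply: contrapT => h'; apply: h; exists j.
    have tp' : 0 <= (t `^ p^-1)^-1 by rewrite invr_ge0 ltW.
    move=> /(rscale_le tp'); rewrite scaler0 scalerA mulVf ?gt_eqF // scale1r => h'.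
    apply: (unit_meet_neq0 wu c0); apply/le_anti.
    by rewrite h' rmeet_ge0.
  have [N hN] := Xv j.
  have c'0 : 0 <= rmeet (rpos (t *: u - pw (v j))) c by rewrite rmeet_ge0 ?rpos_ge0.
  exists N, (rmeet (rpos (t *: u - pw (v j))) c); split.
  - exact: rgt0.
  - exact: rmeetr.
  move=> m n Nm Nn; apply: (spectral_disjoint dc wu c'0).
  apply: (le_on_trans c'0 (le_onW c'0 (hN m n Nm Nn))).
  exact: meet_pos_part.
have gN j n N : (forall m n, (N <= m)%N -> (N <= n)%N ->
      Tu (pw (rabs (f m - f n))) <= pw (v j)) -> (N <= n)%N ->
    dominated (pw (rabs (f n - g))) (pw (v j)).
  by move=> hN Nn; apply: (hg n N) => m; apply: hN.
have gL : L1 (pw (rabs g)).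
  have [N hN] := Xv j0; have [h _] := dominated_L1 (gN j0 N N hN (leqnn _)).
  apply: (L1_pow_triangle (fL' N) h).
  have -> : g = f N - (f N - g) by linear R.
  apply: le_trans (rabsD _ _) _; rewrite rabsN.
  by have -> : f N - (f N - (f N - g)) = f N - g by linear R.
exists g; first by split => //; apply: L1_of_pow.
exists J, leJ, v; split => // j; have [N hN] := Xv j; exists N => n Nn.
have [h1 h2] := dominated_L1 (gN j n N hN Nn).
have p'0 : 0 < p^-1 by rewrite invr_gt0.
rewrite subr0 rabs_id; last exact: rpow_ge0.
by apply: (root_le_rpow dc lc wu p0) => //; apply: Text_ge0.
Qed.

End Finite_exponent.

(** * The exponent infinity *)

Section Infinite_exponent.

(** The infimum defining the norm belongs to the range, as that is closed under
    suprema, hence under infima. *)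
Lemma RT_norm x : (exists2 w, RT w & rabs x <= w) ->
  [/\ RT (Np iota e T +oo%E x), rabs x <= Np iota e T +oo%E x
    & forall w, RT w -> rabs x <= w -> Np iota e T +oo%E x <= w].
Proof.
move=> [w hw xw] /=; set A := [set _ | _].
have A0 : A !=set0 by exists w.
have [|i1 i2] := infimumP (b := rabs x) dc A0; first by move=> a [].
split; last by move=> a ha xa; apply: i1.
  rewrite -(opprK (infimum _ _)); apply: RTN.
  apply: (@RT_lub [set - a | a in A] _ 0) => //.
  - by exists (- w), w.
  - by move=> _ [a [ha _] <-]; apply: RTN.
  - split => [_ [a ha <-]|z hz]; first by rewrite ropp_le i1.
    rewrite -ropp_le opprK; apply: i2 => a ha.
    by rewrite -ropp_le opprK; apply: hz; exists a.
  - exact: RT_L1 RT0.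
  move=> _ [a [_ xa] <-]; rewrite -ropp_le opprK oppr0.
  exact: le_trans (rabs_ge0 x) xa.
by apply: i2 => a [].
Qed.

(** The element [sup_n (f n - a n)] separates the lower bounds [f n - a n] from the
    upper bounds [f n + a n], so it lies within [a n] of [f n]. *)
Lemma complete_infinite f : (forall n, Lp iota e T +oo%E (f n)) ->
  strongly_cauchy iota e T +oo%E f ->
  exists2 g, Lp iota e T +oo%E g & strongly_cvg iota e T +oo%E f g.
Proof.
move=> fL [J [leJ [v [dJ vdec hv]]]].
have [[j0] _ _ _] := dJ; have [vL _ [[_ v0] vinf]] := vdec.
pose Nm x := Np iota e T +oo%E x.
have bdd m n : exists2 w, RT w & rabs (f m - f n) <= w.
  have [_ [a ha fa]] := fL m; have [_ [b hb fb]] := fL n.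
  exists (a + b); first exact: RTD.
  by apply: le_trans (rabsD _ _) _; rewrite rabsN; apply: rle_add.
have Xv j : exists N, forall m n, (N <= m)%N -> (N <= n)%N -> Nm (f m - f n) <= v j.
  have [[a b] hab] := hv j; exists (maxn a b) => m n am bn.
  have /= h := hab (m, n) (conj (leq_trans (leq_maxl _ _) am) (leq_trans (leq_maxr _ _) bn)).
  by rewrite subr0 in h; apply: le_trans (rabs_ge _) h.
have [N0 hN0] := Xv j0.
pose A n := [set Nm (f n - f m) | m in [set m | (n <= m)%N]].
have A0 n : A n !=set0 by exists (Nm (f n - f n)), n => //=.
pose a n := supremum 0 (A n).
have aP n : (N0 <= n)%N -> is_lub (A n) (a n).
  move=> Nn; apply: (supremumP (b := v j0)) => // _ [m nm <-].
  by apply: hN0 => //; apply: leq_trans nm.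
have aR n : (N0 <= n)%N -> RT (a n).
  move=> Nn; apply: (RT_lub (A0 n) _ (aP n Nn) (vL j0)).
    by move=> _ [m _ <-]; case: (RT_norm (bdd n m)).
  by move=> _ [m nm <-]; apply: hN0 => //; apply: leq_trans nm.
have fa m n : (N0 <= n)%N -> (n <= m)%N -> rabs (f n - f m) <= a n.
  move=> Nn nm; have [_ h _] := RT_norm (bdd n m); apply: le_trans h _.
  by case: (aP n Nn) => h _; apply: h; exists m.
have a0 n : (N0 <= n)%N -> 0 <= a n.
  by move=> Nn; apply: le_trans (rabs_ge0 _) (fa n n Nn (leqnn n)).
have sep m n : (N0 <= m)%N -> (N0 <= n)%N -> f n - a n <= f m + a m.
  move=> Nm' Nn; have [nm|/ltnW mn] := leqP n m.
    have h := le_trans (rabs_ge _) (fa m n Nn nm).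
    by apply: (rle_of (rle_add h (a0 m Nm'))); linear R.
  have h := le_trans (rabs_geN _) (fa n m Nm' mn).
  by apply: (rle_of (rle_add h (a0 n Nn))); linear R.
have [||g [g1 g2]] := @lub_exists _ _
    [set f n - a n | n in [set n | (N0 <= n)%N]] (f N0 + a N0) dc.
- by exists (f N0 - a N0), N0 => //=.
- by move=> _ [n Nn <-]; apply: sep.
have gf n : (N0 <= n)%N -> rabs (f n - g) <= a n.
  move=> Nn; have h1 : f n - a n <= g by apply: g1; exists n.
  have h2 : g <= f n + a n by apply: g2 => _ [m Nm' <-]; apply: sep.
  by apply: rabs_lub; [apply: (rle_of h1) | apply: (rle_of h2)]; linear R.
have gb n : (N0 <= n)%N -> exists2 w, RT w & rabs (f n - g) <= w.
  by move=> Nn; exists (a n); [exact: aR | exact: gf].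
have gL : exists2 w, RT w & rabs g <= w.
  have [_ [w hw fw]] := fL N0; have Na := leqnn N0.
  exists (w + a N0); first by apply: RTD => //; apply: aR.
  have -> : g = f N0 + - (f N0 - g) by linear R.
  by apply: le_trans (rabsD _ _) _; rewrite rabsN; apply: rle_add => //; apply: gf.
exists g.
  by split=> //; case: gL => w /RT_L1 hw gw; apply: L1_solid gw hw.
exists J, leJ, v; split => // j; have [N hN] := Xv j; exists (maxn N N0) => n.
rewrite geq_max => /andP[Nn N0n]; rewrite subr0.
have [h1 h2 h3] := RT_norm (gb n N0n).
rewrite rabs_id; last exact: le_trans (rabs_ge0 _) h2.
apply: le_trans (h3 _ (aR n N0n) (gf n N0n)) _.
case: (aP n N0n) => _; apply=> _ [m nm <-]; apply: hN => //.
exact: leq_trans nm.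
Qed.

End Infinite_exponent.

End Conditional_expectation.

Theorem theorem15 (R : realType) (E Eu : rieszType R) (e : E)
    (T : {linear E -> E}) (iota : {linear E -> Eu})
    (hT : cond_riesz_triple e T) (hEu : universal_completion iota)
    (p : \bar R) (hp : (1%:E <= p)%E)
    (f : nat -> Eu) (hf : forall n, Lp iota e T p (f n))
    (hC : strongly_cauchy iota e T p f) :
  exists2 g : Eu, Lp iota e T p g & strongly_cvg iota e T p f g.
Proof.
case: p hp hf hC => [p||//] hp hf hC; last first.
  exact: (complete_infinite hT hEu hf hC).
by apply: (complete_finite hT hEu _ hf hC); rewrite -lee_fin.
Qed.
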